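(* Let $k$ be a field, $X$ a set, $\mathcal{C}$ a formation of algebraic groups over $k$ and $R$ a $k$-algebra. There exists a pro-$\mathcal{C}$-group $\Gamma$ and a map $\iota\colon X\to\Gamma(R)$ such that (i) $\iota$ converges to $1$ and $\langle\iota(X)\rangle$ is a pro-$\mathcal{C}$-group; (ii) the pair $(\Gamma,\iota)$ is universal, i.e., for every pro-$\mathcal{C}$-group $G$ and every map $\varphi\colon X\to G(R)$ converging to $1$ with $\langle\varphi(X)\rangle$ a pro-$\mathcal{C}$-group, there exists a unique morphism $\psi\colon\Gamma\to G$ of proalgebraic groups such that $\psi_R\circ\iota=\varphi$. Moreover, $\langle\iota(X)\rangle=\Gamma$.
   Context: All rings are commutative and unital. An algebraic group is an affine group scheme of finite type over $k$; a proalgebraic group is an affine group scheme over $k$. Closed subgroup means closed subgroup scheme. A morphism $G\to H$ of proalgebraic groups is an epimorphism if the dual map $k[H]\to k[G]$ on coordinate rings is injective (equivalently, it identifies $H$ with a quotient $G/N$ by a normal closed subgroup $N$). A normal closed subgroup $N$ of $G$ is coalgebraic if $G/N$ is algebraic. For a morphism $\psi\colon\Gamma\to G$, $\psi_R\colon\Gamma(R)\to G(R)$ is the induced map on $R$-points. A formation $\mathcal{C}$ is a non-empty class of algebraic groups over $k$, closed under isomorphism and containing a non-trivial group, such that (a) every quotient of a group in $\mathcal{C}$ is in $\mathcal{C}$; (b) if $G_1,G_2\in\mathcal{C}$ and $H\leq G_1\times G_2$ is a closed subgroup such that both projections $H\to G_i$ are epimorphisms, then $H\in\mathcal{C}$.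 A pro-$\mathcal{C}$-group is a proalgebraic group that is a projective limit (over a directed set) of groups in $\mathcal{C}$ with transition maps epimorphisms. A map $\varphi\colon X\to G(R)$, with $G$ a proalgebraic group, converges to $1$ if for every coalgebraic subgroup $N$ of $G$ all but finitely many elements of $X$ are mapped into $N(R)$. For $Y\subseteq G(R)$, $\langle Y\rangle$ denotes the smallest closed subgroup $H$ of $G$ with $Y\subseteq H(R)$. *)

(* Defs.v *)
From HB Require Import structures.
From mathcomp Require Import all_boot all_algebra.
From mathcomp Require Import mpoly.
From mathcomp Require Import boolp classical_sets cardinality.

Set Implicit Arguments.
Unset Strict Implicit.
Unset Printing Implicit Defensive.

Import GRing.Theory.
Local Open Scope classical_set_scope.
Local Open Scope ring_scope.

(* MathComp's [comAlgType k] is restricted to non-trivial rings. As the zero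
   ring is a k-algebra, we use commutative rings with a structure map instead. *)
Record comkalg (k : fieldType) := ComKAlg {
  kalg_ring :> comPzRingType;
  kalg_map : {rmorphism k -> kalg_ring} }.

Record kalghom (k : fieldType) (A B : comkalg k) := KAlgHom {
  kalghom_fun :> {rmorphism A -> B};
  kalghom_map : forall c : k, kalghom_fun (kalg_map A c) = kalg_map B c }.

(* Leibniz equality of algebra morphisms is pointwise equality. *)
Lemma kalghom_eq (k : fieldType) (A B : comkalg k) (f g : kalghom A B) :
  f =1 g -> f = g.
Proof.
case: f g => [[f [[fD] [fM]]] f_map] [[g [[gD] [gM]]] g_map] eq_fg.
have {}eq_fg : f = g by apply: funext.
case: g / eq_fg gD gM g_map => gD gM.
rewrite (Prop_irrelevance gD fD) (Prop_irrelevance gM fM) => g_map.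
by rewrite (Prop_irrelevance g_map f_map).
Qed.

Lemma kalghom_comp_map (k : fieldType) (A B D : comkalg k)
    (g : kalghom B D) (f : kalghom A B) (c : k) :
  (g \o f) (kalg_map A c) = kalg_map D c.
Proof. by rewrite /= !kalghom_map. Qed.

Definition kalghom_comp (k : fieldType) (A B D : comkalg k)
    (g : kalghom B D) (f : kalghom A B) : kalghom A D :=
  KAlgHom (kalghom_fun := g \o f) (kalghom_comp_map g f).

Lemma kalghom_id_map (k : fieldType) (A : comkalg k) (c : k) :
  idfun (kalg_map A c) = kalg_map A c.
Proof. by []. Qed.

Definition kalghom_id (k : fieldType) (A : comkalg k) : kalghom A A :=
  KAlgHom (kalghom_fun := idfun) (@kalghom_id_map k A).

Definition surj (T U : Type) (f : T -> U) := forall u, exists t, f t = u.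

Definition polyalg (k : fieldType) (n : nat) : comkalg k :=
  @ComKAlg k {mpoly k[n]} (@mpolyC n k).

Definition finite_type (k : fieldType) (A : comkalg k) :=
  exists (n : nat) (f : kalghom (polyalg k n) A), surj f.

(* An affine group scheme is a representable group functor: a k-algebra [A]
   together with a group law on [Hom_k(A, S)], natural in the k-algebra [S].
   By Yoneda this is the same as a Hopf algebra structure on [A].  Naturality of
   the unit and of the inverse follows from naturality of the product. *)
Record affgrp (k : fieldType) := AffGrp {
  coord : comkalg k;
  gmul : forall S : comkalg k,
    kalghom coord S -> kalghom coord S -> kalghom coord S;
  gone : forall S : comkalg k, kalghom coord S;
  ginv : forall S : comkalg k, kalghom coord S -> kalghom coord S;
  gmulA : forall S, associative (@gmul S);
  gmul1g : forall S, left_id (gone S) (@gmul S);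
  gmulg1 : forall S, right_id (gone S) (@gmul S);
  gmulVg : forall S, left_inverse (gone S) (@ginv S) (@gmul S);
  gmulgV : forall S, right_inverse (gone S) (@ginv S) (@gmul S);
  gmul_natural : forall (S T : comkalg k) (h : kalghom S T)
      (x y : kalghom coord S),
    kalghom_comp h (gmul x y) = gmul (kalghom_comp h x) (kalghom_comp h y) }.

Definition points (k : fieldType) (G : affgrp k) (S : comkalg k) : Type :=
  kalghom (coord G) S.

Record grphom (k : fieldType) (G H : affgrp k) := GrpHom {
  dual : kalghom (coord H) (coord G);
  grphom_mul : forall (S : comkalg k) (x y : points G S),
    kalghom_comp (gmul x y) dual
    = gmul (kalghom_comp x dual) (kalghom_comp y dual) }.

Definition on_points (k : fieldType) (G H : affgrp k) (psi : grphom G H)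
    (S : comkalg k) (x : points G S) : points H S :=
  kalghom_comp x (dual psi).

Lemma grphom_comp_mul (k : fieldType) (G H K : affgrp k)
    (q : grphom H K) (p : grphom G H) (S : comkalg k) (x y : points G S) :
  kalghom_comp (gmul x y) (kalghom_comp (dual p) (dual q))
  = gmul (kalghom_comp x (kalghom_comp (dual p) (dual q)))
         (kalghom_comp y (kalghom_comp (dual p) (dual q))).
Proof.
have compA (z : points G S) :
    kalghom_comp z (kalghom_comp (dual p) (dual q))
    = kalghom_comp (kalghom_comp z (dual p)) (dual q) by exact: kalghom_eq.
by rewrite !compA grphom_mul grphom_mul.
Qed.

Definition grphom_comp (k : fieldType) (G H K : affgrp k)
    (q : grphom H K) (p : grphom G H) : grphom G K :=
  GrpHom (grphom_comp_mul q p).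

Lemma grphom_id_mul (k : fieldType) (G : affgrp k) (S : comkalg k)
    (x y : points G S) :
  kalghom_comp (gmul x y) (kalghom_id (coord G))
  = gmul (kalghom_comp x (kalghom_id (coord G)))
         (kalghom_comp y (kalghom_id (coord G))).
Proof.
have comp1 (z : points G S) : kalghom_comp z (kalghom_id (coord G)) = z.
  exact: kalghom_eq.
by rewrite !comp1.
Qed.

Definition grphom_id (k : fieldType) (G : affgrp k) : grphom G G :=
  GrpHom (@grphom_id_mul k G).

Definition algebraic (k : fieldType) (G : affgrp k) := finite_type (coord G).

Definition trivial_grp (k : fieldType) (G : affgrp k) :=
  forall (S : comkalg k) (x : points G S), x = gone G S.

Definition epimorphism (k : fieldType) (G H : affgrp k) (p : grphom G H) :=
  injective (dual p).

Definition closed_immersion (k : fieldType) (G H : affgrp k)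
    (j : grphom G H) :=
  surj (dual j).

Definition isomorphic (k : fieldType) (G H : affgrp k) :=
  exists (f : grphom G H) (g : grphom H G),
    grphom_comp g f = grphom_id G /\ grphom_comp f g = grphom_id H.

(* Two [closed_subgroup]s of [G] are the same closed subgroup scheme when they
   have the same points; everything below depends on their points, or on
   [csub] up to isomorphism, only. *)
Record closed_subgroup (k : fieldType) (G : affgrp k) := ClosedSubgroup {
  csub : affgrp k;
  csub_incl : grphom csub G;
  csub_incl_closed : closed_immersion csub_incl }.

Definition csub_points (k : fieldType) (G : affgrp k) (H : closed_subgroup G)
    (S : comkalg k) : set (points G S) :=
  range (@on_points k (csub H) G (csub_incl H) S).
Arguments csub_points {k G} H S _.

Definition csub_le (k : fieldType) (G : affgrp k) (H K : closed_subgroup G) :=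
  forall S : comkalg k, csub_points H S `<=` csub_points K S.

Lemma grphom_id_closed (k : fieldType) (G : affgrp k) :
  closed_immersion (grphom_id G).
Proof. by move=> a; exists a. Qed.

Definition whole (k : fieldType) (G : affgrp k) : closed_subgroup G :=
  ClosedSubgroup (@grphom_id_closed k G).

Definition normal_csub (k : fieldType) (G : affgrp k) (N : closed_subgroup G) :=
  forall (S : comkalg k) (g n : points G S),
    csub_points N S n -> csub_points N S (gmul (gmul g n) (ginv g)).

(* [p] identifies [Q] with [G/N]. *)
Definition is_quotient (k : fieldType) (G : affgrp k) (N : closed_subgroup G)
    (Q : affgrp k) (p : grphom G Q) :=
  epimorphism p /\
  forall (S : comkalg k) (g : points G S),
    csub_points N S g <-> on_points p g = gone Q S.

Definition coalgebraic (k : fieldType) (G : affgrp k)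
    (N : closed_subgroup G) :=
  normal_csub N /\
  exists (Q : affgrp k) (p : grphom G Q), is_quotient N p /\ algebraic Q.

(* [P] with its two projections is the product group functor
   [S |-> G1(S) x G2(S)]. *)
Definition is_product (k : fieldType) (G1 G2 P : affgrp k)
    (pr1 : grphom P G1) (pr2 : grphom P G2) :=
  forall (S : comkalg k) (x1 : points G1 S) (x2 : points G2 S),
    exists! x : points P S, on_points pr1 x = x1 /\ on_points pr2 x = x2.

Record formation (k : fieldType) (C : affgrp k -> Prop) : Prop := Formation {
  formation_algebraic : forall G, C G -> algebraic G;
  formation_iso : forall G H, isomorphic G H -> C G -> C H;
  formation_nontrivial : exists G, C G /\ ~ trivial_grp G;
  formation_quotient :
    forall G H (p : grphom G H), epimorphism p -> C G -> C H;
  formation_subdirect :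
    forall (G1 G2 P : affgrp k) (pr1 : grphom P G1) (pr2 : grphom P G2)
        (H : closed_subgroup P),
      C G1 -> C G2 -> is_product pr1 pr2 ->
      epimorphism (grphom_comp pr1 (csub_incl H)) ->
      epimorphism (grphom_comp pr2 (csub_incl H)) ->
      C (csub H) }.

Record directed (I : Type) (le : I -> I -> Prop) : Prop := Directed {
  directed_inhabited : exists i : I, True;
  directed_refl : forall i, le i i;
  directed_trans : forall i j l, le i j -> le j l -> le i l;
  directed_ub : forall i j, exists l, le i l /\ le j l }.

Record inverse_system (k : fieldType) (I : Type) (le : I -> I -> Prop)
    (F : I -> affgrp k) (t : forall i j, le i j -> grphom (F j) (F i)) : Prop :=
  InverseSystem {
    inverse_system_id : forall i (h : le i i), t i i h = grphom_id (F i);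
    inverse_system_comp : forall i j l (hij : le i j) (hjl : le j l)
        (hil : le i l),
      t i l hil = grphom_comp (t i j hij) (t j l hjl) }.

(* [G] with the projections [p] is the limit of the group functors [F i],
   i.e. [G(S) = lim_i (F i)(S)] for all [S]. *)
Definition is_limit (k : fieldType) (I : Type) (le : I -> I -> Prop)
    (F : I -> affgrp k) (t : forall i j, le i j -> grphom (F j) (F i))
    (G : affgrp k) (p : forall i, grphom G (F i)) :=
  (forall i j (h : le i j), grphom_comp (t i j h) (p j) = p i) /\
  forall (S : comkalg k) (x : forall i, points (F i) S),
    (forall i j (h : le i j), on_points (t i j h) (x j) = x i) ->
    exists! g : points G S, forall i, on_points (p i) g = x i.

Definition pro (k : fieldType) (C : affgrp k -> Prop) (G : affgrp k) :=
  exists (I : Type) (le : I -> I -> Prop) (F : I -> affgrp k)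
      (t : forall i j, le i j -> grphom (F j) (F i))
      (p : forall i, grphom G (F i)),
    [/\ directed le, inverse_system t,
        forall i j (h : le i j), epimorphism (t i j h),
        forall i, C (F i) & is_limit t p].

Definition converges_to_1 (k : fieldType) (X : Type) (G : affgrp k)
    (R : comkalg k) (phi : X -> points G R) :=
  forall N : closed_subgroup G, coalgebraic N ->
    finite_set [set x | ~ csub_points N R (phi x)].

(* [is_generated Y H] says that [H = <Y>]. *)
Definition is_generated (k : fieldType) (G : affgrp k) (R : comkalg k)
    (Y : set (points G R)) (H : closed_subgroup G) :=
  Y `<=` csub_points H R /\
  forall K : closed_subgroup G, Y `<=` csub_points K R -> csub_le H K.

Definition generates_pro (k : fieldType) (C : affgrp k -> Prop) (G : affgrp k)
    (R : comkalg k) (Y : set (points G R)) :=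
  exists H : closed_subgroup G, is_generated Y H /\ pro C (csub H).

(* Main.v *)
From HB Require Import structures.
From mathcomp Require Import all_boot all_algebra.
From mathcomp Require Import mpoly.
From mathcomp Require Import boolp classical_sets cardinality.
Require Import Defs.

(** Call a pair (G, phi), with G in C and phi : X -> G(R) of finite support,
admissible if phi(X) generates G.  A morphism out of G is determined by its
values on phi(X), so that there is at most one morphism between two admissible
pairs: they form a preorder.  It is directed, because two pairs (G, phi) and
(G', phi') are dominated by the closed subgroup of G x G' generated by the
(phi(x), phi'(x)); both of its projections are epimorphisms, so it belongs to C
by the subdirect product axiom.  Gamma is the limit of this system over a set
of representatives, and iota is the limit of the maps phi.

Given G and phi : X -> G(R) as in the universal property, <phi(X)> is the limit
of groups H_j in C, and the projection to each H_j makes phi into an admissible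
pair; the resulting morphisms Gamma -> H_j are compatible because iota(X)
generates Gamma, and they glue to Gamma -> <phi(X)>.

Three facts carry the argument.

- [image_subgroup]: the scheme-theoretic image of a morphism p : H -> G is a
  closed subgroup.  Hence p is an epimorphism as soon as it hits a generating
  set ([generating_epi]), like the two projections above.  This needs that k is a
  field: points of the image extend to linear maps on k[H]
  ([linear_extension]), and a bilinear map on k[H] is well defined on the tensor
  square, where the comultiplication is computed.

- [colim_injective], [colim_surjective]: the coordinate ring of a limit of affine
  groups is the union of the coordinate rings of the stages, and these inject
  into it if the transition maps are epimorphisms.  An algebra of finite type
  therefore only sees one stage ([finite_type_range]), which turns convergence
  to 1 into finite support at each stage ([stage_support]).

- [realizes_hom]: an admissible pair is determined by data on a polynomial ring
  in finitely many variables, so that the representatives are small enough to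
  index a colimit of algebras.

Closed subgroups, products and limits are all obtained from sets of points
which are closed under the group operations ([ps_grp]); the comultiplication
appears only as a finite sum of products, in [comult_exists]. *)

Set Implicit Arguments.
Unset Strict Implicit.
Unset Printing Implicit Defensive.

Import GRing.Theory.
Local Open Scope classical_set_scope.
Local Open Scope ring_scope.

(** * Algebras as quotients of setoids *)

(** The zero and the unit are the constants 0 and 1. *)
Record setoid_alg (k : fieldType) := SetoidAlg {
  sa_sort :> Type;
  sa_eq : sa_sort -> sa_sort -> Prop;
  sa_cst : k -> sa_sort;
  sa_opp : sa_sort -> sa_sort;
  sa_add : sa_sort -> sa_sort -> sa_sort;
  sa_mul : sa_sort -> sa_sort -> sa_sort;
  sa_refl : forall x, sa_eq x x;
  sa_sym : forall x y, sa_eq x y -> sa_eq y x;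
  sa_trans : forall x y z, sa_eq x y -> sa_eq y z -> sa_eq x z;
  sa_oppE : forall x y, sa_eq x y -> sa_eq (sa_opp x) (sa_opp y);
  sa_addE : forall x x' y y', sa_eq x x' -> sa_eq y y' ->
    sa_eq (sa_add x y) (sa_add x' y');
  sa_mulE : forall x x' y y', sa_eq x x' -> sa_eq y y' ->
    sa_eq (sa_mul x y) (sa_mul x' y');
  sa_addA : forall x y z,
    sa_eq (sa_add x (sa_add y z)) (sa_add (sa_add x y) z);
  sa_addC : forall x y, sa_eq (sa_add x y) (sa_add y x);
  sa_add0 : forall x, sa_eq (sa_add (sa_cst 0) x) x;
  sa_addN : forall x, sa_eq (sa_add (sa_opp x) x) (sa_cst 0);
  sa_mulA : forall x y z,
    sa_eq (sa_mul x (sa_mul y z)) (sa_mul (sa_mul x y) z);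
  sa_mulC : forall x y, sa_eq (sa_mul x y) (sa_mul y x);
  sa_mul1 : forall x, sa_eq (sa_mul (sa_cst 1) x) x;
  sa_mulD : forall x y z,
    sa_eq (sa_mul (sa_add x y) z) (sa_add (sa_mul x z) (sa_mul y z));
  sa_cstD : forall c d, sa_eq (sa_cst (c + d)) (sa_add (sa_cst c) (sa_cst d));
  sa_cstM : forall c d, sa_eq (sa_cst (c * d)) (sa_mul (sa_cst c) (sa_cst d)) }.

Definition classes (k : fieldType) (E : setoid_alg k) : Type :=
  {c : E -> Prop | exists x, sa_eq x = c}.

HB.instance Definition _ (k : fieldType) (E : setoid_alg k) :=
  gen_eqMixin (classes E).
HB.instance Definition _ (k : fieldType) (E : setoid_alg k) :=
  gen_choiceMixin (classes E).

Definition class_of (k : fieldType) (E : setoid_alg k) (x : E) : classes E :=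
  exist _ (sa_eq x) (ex_intro _ x erefl).

Definition class_repr (k : fieldType) (E : setoid_alg k) (c : classes E) : E :=
  projT1 (cid (projT2 c)).

Lemma class_ofP (k : fieldType) (E : setoid_alg k) (x y : E) :
  class_of x = class_of y <-> sa_eq x y.
Proof.
split=> [[eq_xy]|exy]; first by rewrite eq_xy; apply: sa_refl.
rewrite /class_of; apply: eq_exist; apply/funext => z; apply/propext; split=> [|ez].
  by apply: sa_trans; apply: sa_sym.
exact: sa_trans ez.
Qed.

Lemma class_reprK (k : fieldType) (E : setoid_alg k) (c : classes E) :
  class_of (class_repr c) = c.
Proof.
case: c => c hc; apply: eq_exist; rewrite /class_repr; case: cid => x /= ->.
by [].
Qed.

Lemma class_ofK (k : fieldType) (E : setoid_alg k) (x : E) :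
  sa_eq (class_repr (class_of x)) x.
Proof. by apply/class_ofP; rewrite class_reprK. Qed.

Lemma class_of_surj (k : fieldType) (E : setoid_alg k) : surj (@class_of k E).
Proof. by move=> c; exists (class_repr c); rewrite class_reprK. Qed.

Definition cl_opp (k : fieldType) (E : setoid_alg k) (c : classes E) :=
  class_of (sa_opp (class_repr c)).
Definition cl_add (k : fieldType) (E : setoid_alg k) (c d : classes E) :=
  class_of (sa_add (class_repr c) (class_repr d)).
Definition cl_mul (k : fieldType) (E : setoid_alg k) (c d : classes E) :=
  class_of (sa_mul (class_repr c) (class_repr d)).

Lemma cl_oppE (k : fieldType) (E : setoid_alg k) (x : E) :
  cl_opp (class_of x) = class_of (sa_opp x).
Proof. by apply/class_ofP/sa_oppE/class_ofK. Qed.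
Lemma cl_addE (k : fieldType) (E : setoid_alg k) (x y : E) :
  cl_add (class_of x) (class_of y) = class_of (sa_add x y).
Proof. by apply/class_ofP/sa_addE; apply/class_ofK. Qed.
Lemma cl_mulE (k : fieldType) (E : setoid_alg k) (x y : E) :
  cl_mul (class_of x) (class_of y) = class_of (sa_mul x y).
Proof. by apply/class_ofP/sa_mulE; apply/class_ofK. Qed.

Lemma cl_addA (k : fieldType) (E : setoid_alg k) : associative (@cl_add k E).
Proof.
move=> c d e; case: (class_of_surj c) (class_of_surj d) (class_of_surj e).
move=> x <- [y <-] [z <-]; rewrite !cl_addE; apply/class_ofP/sa_addA.
Qed.
Lemma cl_addC (k : fieldType) (E : setoid_alg k) : commutative (@cl_add k E).
Proof.
move=> c d; case: (class_of_surj c) (class_of_surj d) => x <- [y <-].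
rewrite !cl_addE; apply/class_ofP/sa_addC.
Qed.
Lemma cl_add0 (k : fieldType) (E : setoid_alg k) :
  left_id (class_of (sa_cst E 0)) (@cl_add k E).
Proof.
move=> c; case: (class_of_surj c) => x <-.
rewrite !cl_addE; apply/class_ofP/sa_add0.
Qed.
Lemma cl_addN (k : fieldType) (E : setoid_alg k) :
  left_inverse (class_of (sa_cst E 0)) (@cl_opp k E) (@cl_add k E).
Proof.
move=> c; case: (class_of_surj c) => x <-.
rewrite cl_oppE !cl_addE; apply/class_ofP/sa_addN.
Qed.

HB.instance Definition _ (k : fieldType) (E : setoid_alg k) :=
  GRing.isZmodule.Build (classes E) (@cl_addA k E) (@cl_addC k E)
    (@cl_add0 k E) (@cl_addN k E).

Lemma cl_mulA (k : fieldType) (E : setoid_alg k) : associative (@cl_mul k E).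
Proof.
move=> c d e; case: (class_of_surj c) (class_of_surj d) (class_of_surj e).
move=> x <- [y <-] [z <-]; rewrite !cl_mulE; apply/class_ofP/sa_mulA.
Qed.
Lemma cl_mulC (k : fieldType) (E : setoid_alg k) : commutative (@cl_mul k E).
Proof.
move=> c d; case: (class_of_surj c) (class_of_surj d) => x <- [y <-].
rewrite !cl_mulE; apply/class_ofP/sa_mulC.
Qed.
Lemma cl_mul1 (k : fieldType) (E : setoid_alg k) :
  left_id (class_of (sa_cst E 1)) (@cl_mul k E).
Proof.
move=> c; case: (class_of_surj c) => x <-.
rewrite !cl_mulE; apply/class_ofP/sa_mul1.
Qed.
Lemma cl_mulD (k : fieldType) (E : setoid_alg k) :
  left_distributive (@cl_mul k E) +%R.
Proof.
move=> c d e; case: (class_of_surj c) (class_of_surj d) (class_of_surj e).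
move=> x <- [y <-] [z <-]; rewrite /GRing.add /= !(cl_mulE,cl_addE).
apply/class_ofP/sa_mulD.
Qed.

HB.instance Definition _ (k : fieldType) (E : setoid_alg k) :=
  GRing.Zmodule_isComPzRing.Build (classes E) (@cl_mulA k E) (@cl_mulC k E)
    (@cl_mul1 k E) (@cl_mulD k E).

Definition class_cst (k : fieldType) (E : setoid_alg k) (c : k) : classes E :=
  class_of (sa_cst E c).

Lemma class_ofD (k : fieldType) (E : setoid_alg k) (x y : E) :
  class_of (sa_add x y) = class_of x + class_of y.
Proof. by rewrite [RHS]cl_addE. Qed.
Lemma class_ofN (k : fieldType) (E : setoid_alg k) (x : E) :
  class_of (sa_opp x) = - class_of x.
Proof. by rewrite [RHS]cl_oppE. Qed.
Lemma class_ofM (k : fieldType) (E : setoid_alg k) (x y : E) :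
  class_of (sa_mul x y) = class_of x * class_of y.
Proof. by rewrite [RHS]cl_mulE. Qed.
Lemma class_cst_zmod (k : fieldType) (E : setoid_alg k) :
  zmod_morphism (@class_cst k E).
Proof.
move=> c d; apply/eqP; rewrite eq_sym subr_eq -class_ofD; apply/eqP/class_ofP.
rewrite -[in X in sa_eq X _](subrK d c); exact: sa_cstD.
Qed.
Lemma class_cst_monoid (k : fieldType) (E : setoid_alg k) :
  monoid_morphism (@class_cst k E).
Proof.
by split=> // c d; rewrite -class_ofM; apply/class_ofP/sa_cstM.
Qed.
HB.instance Definition _ (k : fieldType) (E : setoid_alg k) :=
  GRing.isZmodMorphism.Build k (classes E) (@class_cst k E) (@class_cst_zmod k E).
HB.instance Definition _ (k : fieldType) (E : setoid_alg k) :=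
  GRing.isMonoidMorphism.Build k (classes E) (@class_cst k E)
    (@class_cst_monoid k E).

Definition quot_alg (k : fieldType) (E : setoid_alg k) : comkalg k :=
  @ComKAlg k (classes E) (@class_cst k E).

(** * Algebras defined by their models *)

Lemma kalghom_build (k : fieldType) (A B : comkalg k) (f : A -> B) :
    (forall c, f (kalg_map A c) = kalg_map B c) ->
    {morph f : x y / x + y} -> {morph f : x y / x * y} ->
  exists h : kalghom A B, h =1 f.
Proof.
move=> f_map fD fM.
have f0 : f 0 = 0 by rewrite -(rmorph0 (kalg_map A)) f_map rmorph0.
have f1 : f 1 = 1 by rewrite -(rmorph1 (kalg_map A)) f_map rmorph1.
have fB : zmod_morphism f.
  move=> x y; have fN : f (- y) = - f y.
    by apply/eqP; rewrite -addr_eq0 -fD addNr f0.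
  by rewrite fD fN.
pose fa := GRing.isZmodMorphism.Build _ _ f fB.
pose fm := GRing.isMonoidMorphism.Build _ _ f (conj f1 fM).
pose g : {rmorphism A -> B} := HB.pack f fa fm.
by exists (@KAlgHom k A B g f_map).
Qed.

Record raw_alg (k : fieldType) := RawAlg {
  ra_sort :> Type;
  ra_cst : k -> ra_sort;
  ra_opp : ra_sort -> ra_sort;
  ra_add : ra_sort -> ra_sort -> ra_sort;
  ra_mul : ra_sort -> ra_sort -> ra_sort }.

Record raw_morph (k : fieldType) (T : raw_alg k) (S : comkalg k) (v : T -> S) :
    Prop := RawMorph {
  raw_cst : forall c, v (ra_cst T c) = kalg_map S c;
  raw_opp : forall x, v (ra_opp x) = - v x;
  raw_add : forall x y, v (ra_add x y) = v x + v y;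
  raw_mul : forall x y, v (ra_mul x y) = v x * v y }.

(** Maps out of raw syntax into algebras.  When they respect the operations,
identifying what none of them separates gives an algebra without any axiom to
check, since the axioms hold in every target; each of the maps factors through
this algebra by construction. *)
Definition models (k : fieldType) (T : raw_alg k) :=
  forall S : comkalg k, (T -> S) -> Prop.

Definition sound (k : fieldType) (T : raw_alg k) (M : models T) :=
  forall (S : comkalg k) (v : T -> S), M S v -> raw_morph v.

Definition model_eq (k : fieldType) (T : raw_alg k) (M : models T) (x y : T) :=
  forall (S : comkalg k) (v : T -> S), M S v -> v x = v y.

Definition model_setoid (k : fieldType) (T : raw_alg k) (M : models T)
  (hM : sound M) : setoid_alg k.
Proof.
refine (@SetoidAlg k T (model_eq M) (@ra_cst k T) (@ra_opp k T) (@ra_add k T)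
  (@ra_mul k T) _ _ _ _ _ _ _ _ _ _ _ _ _ _ _ _).
- by [].
- by move=> x y exy S v /exy.
- by move=> x y z exy eyz S v hv; rewrite exy // eyz.
- by move=> x y exy S v hv; rewrite !(raw_opp (hM _ _ hv)) exy.
- by move=> x x' y y' ex ey S v hv; rewrite !(raw_add (hM _ _ hv)) ex ?ey.
- by move=> x x' y y' ex ey S v hv; rewrite !(raw_mul (hM _ _ hv)) ex ?ey.
- by move=> x y z S v /hM hv; rewrite !(raw_add hv) addrA.
- by move=> x y S v /hM hv; rewrite !(raw_add hv) addrC.
- by move=> x S v /hM hv; rewrite (raw_add hv) (raw_cst hv) rmorph0 add0r.
- move=> x S v /hM hv.
  by rewrite (raw_add hv) (raw_opp hv) (raw_cst hv) rmorph0 addNr.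
- by move=> x y z S v /hM hv; rewrite !(raw_mul hv) mulrA.
- by move=> x y S v /hM hv; rewrite !(raw_mul hv) mulrC.
- by move=> x S v /hM hv; rewrite (raw_mul hv) (raw_cst hv) rmorph1 mul1r.
- by move=> x y z S v /hM hv; rewrite !(raw_mul hv, raw_add hv) mulrDl.
- by move=> c d S v /hM hv; rewrite !(raw_cst hv, raw_add hv) rmorphD.
- by move=> c d S v /hM hv; rewrite !(raw_cst hv, raw_mul hv) rmorphM.
Defined.

Definition model_alg (k : fieldType) (T : raw_alg k) (M : models T)
  (hM : sound M) : comkalg k := quot_alg (model_setoid hM).

Definition model_class (k : fieldType) (T : raw_alg k) (M : models T)
  (hM : sound M) (x : T) : model_alg hM := @class_of k (model_setoid hM) x.

Lemma model_class_raw (k : fieldType) (T : raw_alg k) (M : models T)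
  (hM : sound M) : raw_morph (model_class hM).
Proof.
split=> [c|x|x y|x y]; first by [].
- exact: (@class_ofN _ (model_setoid hM)).
- exact: (@class_ofD _ (model_setoid hM)).
- exact: (@class_ofM _ (model_setoid hM)).
Qed.

Lemma model_class_surj (k : fieldType) (T : raw_alg k) (M : models T)
  (hM : sound M) : surj (model_class hM).
Proof. exact: class_of_surj. Qed.

Lemma model_classP (k : fieldType) (T : raw_alg k) (M : models T)
  (hM : sound M) (x y : T) :
  model_class hM x = model_class hM y <-> model_eq M x y.
Proof. exact: (@class_ofP _ (model_setoid hM)). Qed.

Lemma model_alg_univ (k : fieldType) (T : raw_alg k) (M : models T)
    (hM : sound M) (S : comkalg k) (v : T -> S) :
  M S v -> exists h : kalghom (model_alg hM) S, forall x, h (model_class hM x) = v x.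
Proof.
move=> Mv; have hv := hM _ _ Mv; have cl := model_class_raw hM.
pose f (c : model_alg hM) := v (class_repr c).
have fE x : f (model_class hM x) = v x.
  by rewrite /f; apply: (@class_ofK _ (model_setoid hM) x).
have [c|c d|c d|h hE] := @kalghom_build _ _ _ f.
- by rewrite -(raw_cst cl) fE (raw_cst hv).
- case: (model_class_surj c) (model_class_surj d) => x <- [y <-].
  by rewrite -(raw_add cl) !fE (raw_add hv).
- case: (model_class_surj c) (model_class_surj d) => x <- [y <-].
  by rewrite -(raw_mul cl) !fE (raw_mul hv).
by exists h => x; rewrite hE fE.
Qed.

Definition alg_raw (k : fieldType) (A : comkalg k) : raw_alg k :=
  @RawAlg k A (kalg_map A) -%R +%R *%R.

(** The models of the quotient of [A] by the ideal that [E] generates. *)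
Definition killing (k : fieldType) (A : comkalg k) (E : set A) :
    models (alg_raw A) :=
  fun S v => exists2 h : kalghom A S, h =1 v & forall a, E a -> h a = 0.

Lemma killing_sound (k : fieldType) (A : comkalg k) (E : set A) :
  sound (killing E).
Proof.
move=> S v [h hv _]; split=> [c|x|x y|x y]; rewrite -!hv /=.
- exact: kalghom_map.
- exact: rmorphN.
- exact: rmorphD.
- exact: rmorphM.
Qed.

Lemma quotient_exists (k : fieldType) (A : comkalg k) (E : set A) :
  exists (B : comkalg k) (q : kalghom A B), [/\ surj q,
    forall a, E a -> q a = 0 &
    forall (S : comkalg k) (x : kalghom A S), (forall a, E a -> x a = 0) ->
      exists y : kalghom B S, kalghom_comp y q = x].
Proof.
have cl := model_class_raw (@killing_sound k A E).
have [c|x y|x y|q qE] := @kalghom_build k A (model_alg (@killing_sound k A E))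
  (model_class (@killing_sound k A E)).
- exact: (raw_cst cl).
- exact: (raw_add cl).
- exact: (raw_mul cl).
exists (model_alg (@killing_sound k A E)), q; split.
- move=> b; case: (model_class_surj b) => a <-; exists a; exact: qE.
- move=> a Ea; rewrite -(rmorph0 q) !qE; apply/model_classP => S v [h hv hE].
  by rewrite -!hv hE // rmorph0.
move=> S x xE.
have [|y yE] := @model_alg_univ _ _ _ (@killing_sound k A E) S x; first by exists x.
by exists y; apply: kalghom_eq => a /=; rewrite qE yE.
Qed.

(** * Directed colimits *)

Definition cone (k : fieldType) (I : Type) (le : I -> I -> Prop)
    (A : I -> comkalg k) (t : forall i j, le i j -> kalghom (A i) (A j))
    (S : comkalg k) (x : forall i, kalghom (A i) S) :=
  forall i j (h : le i j), kalghom_comp (x j) (t i j h) = x i.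

Definition is_colim (k : fieldType) (I : Type) (le : I -> I -> Prop)
    (A : I -> comkalg k) (t : forall i j, le i j -> kalghom (A i) (A j))
    (B : comkalg k) (u : forall i, kalghom (A i) B) :=
  cone t u /\ forall S (x : forall i, kalghom (A i) S), cone t x ->
    exists! y : kalghom B S, forall i, kalghom_comp y (u i) = x i.

(** As the identifications are tested on cones, the operations, computed at any
upper bound of two stages, are automatically compatible with them. *)
Definition colim_models (k : fieldType) (I : Type) (le : I -> I -> Prop)
    (A : I -> comkalg k) (t : forall i j, le i j -> kalghom (A i) (A j))
    (T : raw_alg k) (inc : forall i, A i -> T) : models T :=
  fun S v => exists2 x : forall i, kalghom (A i) S,
    cone t x & forall i a, v (inc i a) = x i a.
Arguments colim_models {k I le A} t T inc S v.

Lemma colim_exists (k : fieldType) (I : Type) (le : I -> I -> Prop)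
    (A : I -> comkalg k) (t : forall i j, le i j -> kalghom (A i) (A j)) :
  directed le -> exists (B : comkalg k) (u : forall i, kalghom (A i) B),
    is_colim t u /\ forall b, exists i a, u i a = b.
Proof.
move=> dir.
pose ub (i j : I) := projT1 (cid (directed_ub dir i j)).
have ubl i j : le i (ub i j) by rewrite /ub; case: cid => l [].
have ubr i j : le j (ub i j) by rewrite /ub; case: cid => l [].
have [i0 _] := directed_inhabited dir.
pose inc i (a : A i) : {i : I & A i} := existT _ i a.
pose op2 (op : forall i, A i -> A i -> A i) (s r : {i : I & A i}) :=
  inc _ (op _ (t _ _ (ubl (projT1 s) (projT1 r)) (projT2 s))
              (t _ _ (ubr (projT1 s) (projT1 r)) (projT2 r))).
pose T := @RawAlg k {i : I & A i} (fun c => inc i0 (kalg_map (A i0) c))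
  (fun s => inc _ (- projT2 s)) (op2 (fun i => +%R)) (op2 (fun i => *%R)).
have coneE S (x : forall i, kalghom (A i) S) i j (h : le i j) a :
    cone t x -> x j (t i j h a) = x i a.
  by move=> cx; rewrite -(cx i j h).
have hM : sound (colim_models t T inc).
  move=> S v [x cx vE]; split=> [c|[i a]|[i a] [j b]|[i a] [j b]] /=.
  - by rewrite vE kalghom_map.
  - by rewrite !vE rmorphN.
  - by rewrite !vE rmorphD !coneE.
  - by rewrite !vE rmorphM !coneE.
pose B := model_alg hM; have cl := model_class_raw hM.
have uP i : exists h : kalghom (A i) B, forall a, h a = model_class hM (inc i a).
  apply: kalghom_build => [c|a b|a b].
  - rewrite -(raw_cst cl); apply/model_classP => S v hv.
    rewrite (raw_cst (hM _ _ hv)); case: hv => x cx vE; by rewrite !vE kalghom_map.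
  - rewrite -(raw_add cl); apply/model_classP => S v hv.
    rewrite (raw_add (hM _ _ hv)); case: hv => x cx vE; by rewrite !vE rmorphD.
  - rewrite -(raw_mul cl); apply/model_classP => S v hv.
    rewrite (raw_mul (hM _ _ hv)); case: hv => x cx vE; by rewrite !vE rmorphM.
pose u i := projT1 (cid (uP i)).
have uE i a : u i a = model_class hM (inc i a) by rewrite /u; case: cid.
exists B, u; split; last first.
  by move=> b; have [[i a] <-] := model_class_surj b; exists i, a; exact: uE.
split=> [i j h|S x cx].
  apply: kalghom_eq => a /=; rewrite !uE; apply/model_classP => S v [x cx vE].
  by rewrite !vE coneE.
have [|y yE] := @model_alg_univ _ _ _ hM S (fun s => x (projT1 s) (projT2 s)).
  by exists x.
exists y; split=> [i|z zE]; first by apply: kalghom_eq => a /=; rewrite uE yE.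
apply: kalghom_eq => b; have [[i a] <-] := model_class_surj b.
by rewrite yE -[x _ _]/(x i a) -zE /= uE.
Qed.

(** The target of a cone that is injective on each stage when the transition
maps are: germs at infinity of sections of the family. *)
Lemma germs_exist (k : fieldType) (I : Type) (le : I -> I -> Prop)
    (A : I -> comkalg k) :
  directed le ->
  exists (B : comkalg k) (g : (forall i, A i) -> B),
   [/\ forall x y, g x = g y <-> exists i, forall j, le i j -> x j = y j,
    forall c, g (fun i => kalg_map (A i) c) = kalg_map B c,
    forall x y, g (fun i => x i + y i) = g x + g y &
    forall x y, g (fun i => x i * y i) = g x * g y].
Proof.
move=> dir; have [i0 _] := directed_inhabited dir.
pose eqg (x y : forall i, A i) := exists i, forall j, le i j -> x j = y j.
have eqW (x y : forall i, A i) : (forall i, x i = y i) -> eqg x y.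
  by move=> xy; exists i0.
have op2 (D : I -> Type) (op : forall i, A i -> A i -> D i)
    (x x' y y' : forall i, A i) : eqg x x' -> eqg y y' ->
    exists i, forall j, le i j -> op j (x j) (y j) = op j (x' j) (y' j).
  move=> [i xE] [j yE]; have [l [il jl]] := directed_ub dir i j.
  exists l => m lm; rewrite xE ?yE //; exact: (directed_trans dir _ lm).
have @E : setoid_alg k.
  refine (@SetoidAlg k (forall i, A i) eqg
    (fun c i => kalg_map (A i) c) (fun x i => - x i)
    (fun x y i => x i + y i) (fun x y i => x i * y i)
    _ _ _ _ _ _ _ _ _ _ _ _ _ _ _ _).
  - by move=> x; exact: eqW.
  - by move=> x y [i xy]; exists i => j /xy.
  - move=> x y z xy yz; have [i h] := op2 _ (fun i a b => (a, b)) _ _ _ _ xy yz.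
    by exists i => j /h [-> ->].
  - by move=> x y [i xy]; exists i => j /xy ->.
  - by move=> x x' y y'; exact: op2 (fun i => +%R) _ _ _ _.
  - by move=> x x' y y'; exact: op2 (fun i => *%R) _ _ _ _.
  - by move=> x y z; apply: eqW => i; rewrite addrA.
  - by move=> x y; apply: eqW => i; rewrite addrC.
  - by move=> x; apply: eqW => i; rewrite rmorph0 add0r.
  - by move=> x; apply: eqW => i; rewrite rmorph0 addNr.
  - by move=> x y z; apply: eqW => i; rewrite mulrA.
  - by move=> x y; apply: eqW => i; rewrite mulrC.
  - by move=> x; apply: eqW => i; rewrite rmorph1 mul1r.
  - by move=> x y z; apply: eqW => i; rewrite mulrDl.
  - by move=> c d; apply: eqW => i; rewrite rmorphD.
  - by move=> c d; apply: eqW => i; rewrite rmorphM.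
exists (quot_alg E), (@class_of k E); split.
- by move=> x y; exact: class_ofP.
- by [].
- by move=> x y; exact: (@class_ofD k E).
- by move=> x y; exact: (@class_ofM k E).
Qed.

(** An element of a stage is sent to the germ of its images at later stages, and
this cone factors through the colimit. *)
Lemma colim_injective (k : fieldType) (I : Type) (le : I -> I -> Prop)
    (A : I -> comkalg k) (t : forall i j, le i j -> kalghom (A i) (A j))
    (B : comkalg k) (u : forall i, kalghom (A i) B) :
  directed le ->
  (forall i j l (ij : le i j) (jl : le j l) (il : le i l),
     kalghom_comp (t j l jl) (t i j ij) = t i l il) ->
  (forall i j (h : le i j), injective (t i j h)) ->
  is_colim t u -> forall i, injective (u i).
Proof.
move=> dir tcomp tinj [_ uni] i0.
have [D [g [gE gc gD gM]]] := germs_exist A dir.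
pose ext i (a : A i) j : A j :=
  if pselect (le i j) is left h then t i j h a else 0.
have extE i (a : A i) j (h : le i j) : ext i a j = t i j h a.
  by rewrite /ext; case: pselect => // h'; rewrite (Prop_irrelevance h h').
have xP i : exists h : kalghom (A i) D, forall a, h a = g (ext i a).
  apply: kalghom_build => [c|a b|a b].
  - rewrite -gc; apply/gE; exists i => j ij.
    by rewrite (extE _ _ _ ij) kalghom_map.
  - rewrite -gD; apply/gE; exists i => j ij.
    by rewrite !(extE _ _ _ ij) rmorphD.
  - rewrite -gM; apply/gE; exists i => j ij.
    by rewrite !(extE _ _ _ ij) rmorphM.
pose x i := projT1 (cid (xP i)).
have xE i a : x i a = g (ext i a) by rewrite /x; case: cid.
have cx : cone t x.
  move=> i j ij; apply: kalghom_eq => a /=; rewrite !xE; apply/gE; exists j => l jl.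
  have il := directed_trans dir ij jl.
  by rewrite (extE _ _ _ jl) (extE _ _ _ il) -(tcomp _ _ _ ij jl il).
have [y [yE _]] := uni _ _ cx.
move=> a b eq_ab; have : x i0 a = x i0 b by rewrite -yE /= eq_ab.
rewrite !xE => /gE [j jE]; have [l [il jl]] := directed_ub dir i0 j.
by apply: (tinj _ _ il); rewrite -!extE jE.
Qed.

(** The colimit of [colim_exists] is a union of stages, and the universal property
makes any other colimit isomorphic to it. *)
Lemma colim_surjective (k : fieldType) (I : Type) (le : I -> I -> Prop)
    (A : I -> comkalg k) (t : forall i j, le i j -> kalghom (A i) (A j))
    (B : comkalg k) (u : forall i, kalghom (A i) B) :
  directed le -> is_colim t u -> forall b, exists i a, u i a = b.
Proof.
move=> dir [cu uni] b.
have [D [v [[cv vuni] vsurj]]] := colim_exists t dir.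
have [y [yE _]] := uni _ _ cv; have [z [zE _]] := vuni _ _ cu.
have zy : kalghom_comp z y = kalghom_id B.
  have [w [_ wuni]] := uni _ _ cu.
  rewrite -(wuni (kalghom_id B)) => [|i]; last exact: kalghom_eq.
  apply/esym/wuni => i; apply: kalghom_eq => a /=.
  rewrite -[y _]/(kalghom_comp y (u i) a) yE.
  by rewrite -[LHS]/(kalghom_comp z (v i) a) zE.
have [i [a vE]] := vsurj (y b); exists i, a.
by rewrite -zE /= vE -[LHS]/(kalghom_comp z y b) zy.
Qed.

(** * Tensor products and comultiplication *)

Record bilin (k : fieldType) (A B S : comkalg k) (F : A -> B -> S) : Prop :=
  Bilin {
  bilinDl : forall a a' b, F (a + a') b = F a b + F a' b;
  bilinDr : forall a b b', F a (b + b') = F a b + F a b';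
  bilinZl : forall c a b, F (kalg_map A c * a) b = kalg_map S c * F a b;
  bilinZr : forall c a b, F a (kalg_map B c * b) = kalg_map S c * F a b }.

Lemma bilin_mul (k : fieldType) (A B S : comkalg k) (F : A -> B -> S) a b :
  bilin F -> bilin (fun a' b' => F (a * a') (b * b')).
Proof.
move=> hF; split=> *; rewrite ?mulrDr ?(bilinDl hF) ?(bilinDr hF) //.
- by rewrite mulrCA (bilinZl hF).
- by rewrite (mulrCA b) (bilinZr hF).
Qed.

Definition pairing (k : fieldType) (A B S : comkalg k) (F : A -> B -> S)
  (l : seq (A * B)) : S := \sum_(p <- l) F p.1 p.2.

(** A list of pairs stands for the sum of its pure tensors.  Testing against all
bilinear maps, and not against products of algebra morphisms only, is what
makes bilinear maps well defined on the tensor product. *)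
Definition tensor_eq (k : fieldType) (A B : comkalg k) (l m : seq (A * B)) :=
  forall (S : comkalg k) (F : A -> B -> S), bilin F -> pairing F l = pairing F m.

Definition tensor_mul (k : fieldType) (A B : comkalg k) (l m : seq (A * B)) :=
  [seq (p.1 * q.1, p.2 * q.2) | p <- l, q <- m].

Lemma pairing_mul (k : fieldType) (A B S : comkalg k) (F : A -> B -> S)
    (l m : seq (A * B)) :
  pairing F (tensor_mul l m)
  = \sum_(p <- l) \sum_(q <- m) F (p.1 * q.1) (p.2 * q.2).
Proof. by rewrite /pairing big_allpairs_dep. Qed.

Lemma pairing_seq1 (k : fieldType) (A B S : comkalg k) (F : A -> B -> S) a b :
  pairing F [:: (a, b)] = F a b.
Proof. by rewrite /pairing big_seq1. Qed.

Lemma pairing_cat (k : fieldType) (A B S : comkalg k) (F : A -> B -> S) l m :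
  pairing F (l ++ m) = pairing F l + pairing F m.
Proof. exact: big_cat. Qed.

Lemma pairing_opp (k : fieldType) (A B S : comkalg k) (F : A -> B -> S) l :
  bilin F -> pairing F [seq (- p.1, p.2) | p <- l] = - pairing F l.
Proof.
move=> hF; rewrite /pairing big_map -sumrN; apply: eq_bigr => p _ /=.
have -> : - p.1 = kalg_map A (-1) * p.1 by rewrite rmorphN1 mulN1r.
by rewrite (bilinZl hF) rmorphN1 mulN1r.
Qed.

Lemma tensor_mulC (k : fieldType) (A B : comkalg k) (l m : seq (A * B)) :
  tensor_eq (tensor_mul l m) (tensor_mul m l).
Proof.
move=> S F _; rewrite !pairing_mul exchange_big /=.
by under eq_bigr do under eq_bigr do rewrite mulrC (mulrC _.2).
Qed.

Lemma tensor_mul_eqr (k : fieldType) (A B : comkalg k) (l m m' : seq (A * B)) :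
  tensor_eq m m' -> tensor_eq (tensor_mul l m) (tensor_mul l m').
Proof.
move=> em S F hF; rewrite !pairing_mul; apply: eq_bigr => p _.
exact: (em _ _ (bilin_mul p.1 p.2 hF)).
Qed.

Lemma tensor_eq_trans (k : fieldType) (A B : comkalg k) (l m n : seq (A * B)) :
  tensor_eq l m -> tensor_eq m n -> tensor_eq l n.
Proof. by move=> lm mn S F hF; rewrite lm // mn. Qed.

Definition tensor_setoid (k : fieldType) (A B : comkalg k) : setoid_alg k.
Proof.
refine (@SetoidAlg k (seq (A * B)) (@tensor_eq k A B)
  (fun c => [:: (kalg_map A c, 1)]) (map (fun p => (- p.1, p.2))) cat
  (@tensor_mul k A B) _ _ _ _ _ _ _ _ _ _ _ _ _ _ _ _).
- by [].
- by move=> l m lm S F hF; rewrite lm.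
- exact: tensor_eq_trans.
- by move=> l m lm S F hF; rewrite !pairing_opp // lm.
- by move=> l l' m m' ll mm S F hF; rewrite !pairing_cat ll // mm.
- move=> l l' m m' ll mm; apply: (@tensor_eq_trans _ _ _ _ (tensor_mul l m')).
    exact: tensor_mul_eqr.
  apply: (tensor_eq_trans (tensor_mulC _ _)).
  apply: (tensor_eq_trans _ (tensor_mulC _ _)); exact: tensor_mul_eqr.
- by move=> l m n S F hF; rewrite catA.
- by move=> l m S F hF; rewrite !pairing_cat addrC.
- move=> l S F hF; rewrite pairing_cat pairing_seq1 -[kalg_map A 0]mulr1.
  by rewrite (bilinZl hF) rmorph0 mul0r add0r.
- move=> l S F hF; rewrite pairing_cat pairing_opp // addNr pairing_seq1.
  by rewrite -[kalg_map A 0]mulr1 (bilinZl hF) rmorph0 mul0r.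
- move=> l m n S F hF; rewrite !pairing_mul /tensor_mul big_allpairs_dep.
  apply: eq_bigr => p _; rewrite big_allpairs_dep.
  by do 2![apply: eq_bigr => ? _]; rewrite /= !mulrA.
- exact: tensor_mulC.
- move=> l S F hF; rewrite pairing_mul big_seq1.
  by apply: eq_bigr => p _; rewrite rmorph1 !mul1r.
- by move=> l m n S F hF; rewrite pairing_cat !pairing_mul big_cat.
- move=> c d S F hF; rewrite pairing_cat !pairing_seq1 rmorphD.
  exact: bilinDl.
- by move=> c d S F hF; rewrite pairing_mul !big_seq1 pairing_seq1 rmorphM mul1r.
Defined.

Lemma bilin_prod (k : fieldType) (A B S : comkalg k) (x : A -> S) (y : B -> S) :
  {morph x : a b / a + b} -> (forall c a, x (kalg_map A c * a) = kalg_map S c * x a) ->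
  {morph y : a b / a + b} -> (forall c b, y (kalg_map B c * b) = kalg_map S c * y b) ->
  bilin (fun a b => x a * y b).
Proof.
move=> xD xZ yD yZ; split=> *; rewrite ?xD ?yD ?xZ ?yZ ?mulrDl ?mulrDr //.
  by rewrite mulrA.
by rewrite mulrCA.
Qed.

Lemma kalghomZ (k : fieldType) (A S : comkalg k) (x : kalghom A S) c a :
  x (kalg_map A c * a) = kalg_map S c * x a.
Proof. by rewrite rmorphM kalghom_map. Qed.

Lemma tensor_exists (k : fieldType) (A B : comkalg k) :
  exists (T : comkalg k) (i1 : kalghom A T) (i2 : kalghom B T),
  [/\ forall z, exists l, z = pairing (fun a b => i1 a * i2 b) l,
    forall (S : comkalg k) (F : A -> B -> S) l m, bilin F ->
      pairing (fun a b => i1 a * i2 b) l = pairing (fun a b => i1 a * i2 b) m ->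
      pairing F l = pairing F m &
    forall (S : comkalg k) (x : kalghom A S) (y : kalghom B S),
      exists h : kalghom T S, kalghom_comp h i1 = x /\ kalghom_comp h i2 = y].
Proof.
pose E := tensor_setoid A B; pose T := quot_alg E.
pose cl : seq (A * B) -> T := @class_of k E.
have clP l m : cl l = cl m <-> tensor_eq l m by exact: (@class_ofP k E).
have clD l m : cl (l ++ m) = cl l + cl m by exact: (@class_ofD k E).
have clM l m : cl (tensor_mul l m) = cl l * cl m by exact: (@class_ofM k E).
have cl_surj : surj cl by exact: (@class_of_surj k E).
have [c|a a'|a a'|i1 i1E] := @kalghom_build k A T (fun a => cl [:: (a, 1)]).
- by [].
- rewrite -clD; apply/clP => S F hF.
  by rewrite pairing_cat !pairing_seq1 (bilinDl hF).
- rewrite -clM; apply/clP => S F hF.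
  by rewrite pairing_mul !big_seq1 pairing_seq1 mulr1.
have [c|b b'|b b'|i2 i2E] := @kalghom_build k B T (fun b => cl [:: (1, b)]).
- apply/clP => S F hF; rewrite !pairing_seq1.
  by rewrite -[in LHS](mulr1 (kalg_map B c)) -[in RHS](mulr1 (kalg_map A c))
    (bilinZl hF) (bilinZr hF).
- rewrite -clD; apply/clP => S F hF.
  by rewrite pairing_cat !pairing_seq1 (bilinDr hF).
- rewrite -clM; apply/clP => S F hF.
  by rewrite pairing_mul !big_seq1 pairing_seq1 mulr1.
have clE l : cl l = pairing (fun a b => i1 a * i2 b) l.
  elim: l => [|[a b] l IHl].
    rewrite /pairing big_nil -(rmorph0 (kalg_map T)); apply/clP => S F hF.
    rewrite pairing_seq1 -[kalg_map A 0]mulr1 (bilinZl hF) rmorph0 mul0r.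
    by rewrite /pairing big_nil.
  rewrite -cat1s clD pairing_cat IHl pairing_seq1 i1E i2E -clM; congr (_ + _).
  by apply/clP => S F hF; rewrite pairing_mul !big_seq1 pairing_seq1 mulr1 mul1r.
exists T, i1, i2; split=> [z|S F l m hF|S x y].
- by have [l <-] := cl_surj z; exists l.
- by rewrite -!clE => /clP; apply.
pose F a b := x a * y b.
have hF : bilin F by apply: bilin_prod; [exact: rmorphD|exact: kalghomZ..|exact: rmorphD|exact: kalghomZ].
pose rep (z : T) := projT1 (cid (cl_surj z)).
have repE l : pairing F (rep (cl l)) = pairing F l.
  by rewrite /rep; case: cid => m /= /clP; apply.
have [c|z w|z w|h hE] := @kalghom_build k T S (fun z => pairing F (rep z)).
- by rewrite [LHS]repE pairing_seq1 /F rmorph1 mulr1 kalghom_map.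
- case: (cl_surj z) (cl_surj w) => l <- [m <-].
  by rewrite -clD !repE pairing_cat.
- case: (cl_surj z) (cl_surj w) => l <- [m <-].
  rewrite -clM !repE pairing_mul /pairing mulr_suml; apply: eq_bigr => p _.
  rewrite mulr_sumr; apply: eq_bigr => q _.
  by rewrite /F !rmorphM mulrACA.
exists h; split; apply: kalghom_eq => a /=.
  by rewrite hE i1E repE pairing_seq1 /F rmorph1 mulr1.
by rewrite hE i2E repE pairing_seq1 /F rmorph1 mul1r.
Qed.

(** By naturality the product of two points is computed from the product of the
two universal points in the tensor square. *)
Lemma comult_exists (k : fieldType) (G : affgrp k) (a : coord G) :
  exists l : seq (coord G * coord G), forall (S : comkalg k) (x y : points G S),
    gmul x y a = pairing (fun b c => x b * y c) l.
Proof.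
have [T [i1 [i2 [gen _ univ]]]] := tensor_exists (coord G) (coord G).
have [l lE] := gen (gmul i1 i2 a); exists l => S x y.
have [h [<- <-]] := univ S x y.
rewrite -gmul_natural /= lE /pairing rmorph_sum; apply: eq_bigr => p _.
by rewrite rmorphM.
Qed.

(** * Extension of linear maps *)

(** Zorn's lemma for the graphs of partial linear maps that extend [x]. *)
Lemma linear_extension (k : fieldType) (A S : comkalg k) (D : set A)
    (x : A -> S) :
  D 0 -> (forall a b, D a -> D b -> D (a + b)) ->
  (forall c a, D a -> D (kalg_map A c * a)) ->
  (forall a b, D a -> D b -> x (a + b) = x a + x b) ->
  (forall c a, D a -> x (kalg_map A c * a) = kalg_map S c * x a) ->
  exists X : A -> S, [/\ {morph X : a b / a + b},
    forall c a, X (kalg_map A c * a) = kalg_map S c * X a &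
    forall a, D a -> X a = x a].
Proof.
move=> D0 DD DZ xD xZ.
pose good (P : set (A * S)) := [/\ forall a, D a -> P (a, x a),
  forall p q, P p -> P q -> P (p.1 + q.1, p.2 + q.2),
  forall c p, P p -> P (kalg_map A c * p.1, kalg_map S c * p.2) &
  forall s, P (0, s) -> s = 0].
have x0 : x 0 = 0.
  by have := xZ 0 0 D0; rewrite !rmorph0 !mul0r.
pose base : set (A * S) := [set p | D p.1 /\ p.2 = x p.1].
have good_base : good base.
  split=> [a Da|[a s] [b r] [/= Da /= ->] [/= Db /= ->]|c [a s] [/= Da /= ->]|s [_ /= ->]] //.
  - by split; [exact: DD | rewrite xD].
  - by split; [exact: DZ | rewrite xZ].
have [F FP totF|P [gP maxP]] := @Zorn_bigcup _ (fun P => P = set0 \/ good P).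
  (* The empty set is there for the union of the empty chain. *)
  have [Fne|F0] := pselect (exists2 P, F P & good P); last first.
    left; apply/seteqP; split=> // p [P FP' Pp].
    have [P0|gP] := FP _ FP'; first by rewrite P0 in Pp.
    by case: F0; exists P.
  right; have [P0 FP0 gP0] := Fne.
  have gF P p : F P -> P p -> good P.
    by move=> /FP [->|].
  have up p q : (\bigcup_(P in F) P) p -> (\bigcup_(P in F) P) q ->
      exists P, [/\ F P, good P, P p & P q].
    move=> [P FP' Pp] [Q FQ Qq].
    have [PQ|QP] := totF _ _ FP' FQ.
      by exists Q; split=> //; [exact: gF FQ Qq | exact: PQ].
    by exists P; split=> //; [exact: gF FP' Pp | exact: QP].
  split=> [a Da|p q Up Uq|c p Up|s Us].
  - by exists P0 => //; case: gP0 => h _ _ _; exact: h.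
  - have [P [FP' [_ h _ _] Pp Pq]] := up _ _ Up Uq.
    by exists P => //; exact: h.
  - have [P [FP' [_ _ h _] Pp _]] := up _ _ Up Up.
    by exists P => //; exact: h.
  - have [P [FP' [_ _ _ h] Pp _]] := up _ _ Us Us; exact: h.
have {gP} [Pext PD PZ P0] : good P.
  case: gP => // P0; case: (maxP base); last by right.
  rewrite P0; split=> // h; have := h (0, x 0); apply.
  by split.
have PN a s : P (a, s) -> P (- a, - s).
  by move=> /(PZ (-1)) /=; rewrite !rmorphN1 !mulN1r.
have Puniq a s r : P (a, s) -> P (a, r) -> s = r.
  move=> Ps /PN Pr; have := PD _ _ Ps Pr; rewrite /= subrr => /P0 /eqP.
  by rewrite subr_eq0 => /eqP.
have Ptot a : exists s, P (a, s).
  apply: contrapT => Pa.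
  pose Q : set (A * S) := [set p | exists c, P (p.1 - kalg_map A c * a, p.2)].
  have PQ : P `<=` Q.
    by move=> [b s] Pbs; exists 0; rewrite rmorph0 mul0r subr0.
  (* [Q] extends the map by 0 on [a]. *)
  case: (maxP Q).
    split=> // QP; apply: Pa; exists 0; apply: QP; exists 1.
    by rewrite rmorph1 mul1r subrr -x0; apply: Pext.
  right; split=> [b Db|p q [c Pp] [d Pq]|c p [d Pp]|s [c Pc]].
  - by apply: PQ; exact: Pext.
  - exists (c + d); have := PD _ _ Pp Pq.
    by rewrite /= addrACA -opprD -mulrDl rmorphD.
  - exists (c * d); have := PZ c _ Pp.
    by rewrite /= mulrBr rmorphM mulrA.
  - have [c0|c_neq0] := eqVneq c 0.
      by apply: P0; move: Pc; rewrite /= c0 rmorph0 mul0r subr0.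
    case: Pa; exists (kalg_map S (- c^-1) * s).
    have := PZ (- c^-1) _ Pc; rewrite /= sub0r mulrN rmorphN mulNr opprK.
    by rewrite mulrA -rmorphM mulVf // rmorph1 mul1r.
pose X a := projT1 (cid (Ptot a)).
have XP a : P (a, X a) by rewrite /X; case: cid.
exists X; split=> [a b|c a|a Da].
- exact: Puniq (XP _) (PD _ _ (XP a) (XP b)).
- exact: Puniq (XP _) (PZ c _ (XP a)).
- exact: Puniq (XP _) (Pext _ Da).
Qed.

(** * Morphisms and points *)

Lemma kalghom_compA (k : fieldType) (A B D E : comkalg k) (h : kalghom D E)
    (g : kalghom B D) (f : kalghom A B) :
  kalghom_comp h (kalghom_comp g f) = kalghom_comp (kalghom_comp h g) f.
Proof. exact: kalghom_eq. Qed.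

Lemma kalghom_comp1 (k : fieldType) (A B : comkalg k) (f : kalghom A B) :
  kalghom_comp f (kalghom_id A) = f.
Proof. exact: kalghom_eq. Qed.

Lemma grphom_eq (k : fieldType) (G H : affgrp k) (p q : grphom G H) :
  dual p = dual q -> p = q.
Proof.
case: p q => [f fM] [g gM] /= fg; case: _ / fg gM => gM.
by rewrite (Prop_irrelevance fM gM).
Qed.

Lemma surj_factor (k : fieldType) (A B S : comkalg k) (q : kalghom A B)
    (x : kalghom A S) :
  surj q -> (forall a, q a = 0 -> x a = 0) ->
  exists y : kalghom B S, kalghom_comp y q = x.
Proof.
move=> qs xq; pose s b := projT1 (cid (qs b)).
have sK b : q (s b) = b by rewrite /s; case: cid.
have xs a : x (s (q a)) = x a.
  by apply/eqP; rewrite -subr_eq0 -rmorphB; apply/eqP/xq; rewrite rmorphB sK subrr.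
have [c|b d|b d|y yE] := @kalghom_build k B S (fun b => x (s b)).
- by rewrite -(kalghom_map q) xs kalghom_map.
- by rewrite -{1}(sK b) -{1}(sK d) -rmorphD xs rmorphD.
- by rewrite -{1}(sK b) -{1}(sK d) -rmorphM xs rmorphM.
by exists y; apply: kalghom_eq => a /=; rewrite yE xs.
Qed.

Lemma gmul_idem (k : fieldType) (G : affgrp k) (S : comkalg k) (x : points G S) :
  gmul x x = x -> x = gone G S.
Proof. by move=> xx; rewrite -[LHS](gmul1g x) -(gmulVg x) -gmulA xx. Qed.

Lemma gmul_inv_uniq (k : fieldType) (G : affgrp k) (S : comkalg k)
    (x y : points G S) :
  gmul y x = gone G S -> y = ginv x.
Proof. by move=> yx; rewrite -[LHS](gmulg1 y) -(gmulgV x) gmulA yx gmul1g. Qed.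

Lemma gone_natural (k : fieldType) (G : affgrp k) (S T : comkalg k)
    (h : kalghom S T) : kalghom_comp h (gone G S) = gone G T.
Proof. by apply: gmul_idem; rewrite -gmul_natural gmul1g. Qed.

Lemma ginv_natural (k : fieldType) (G : affgrp k) (S T : comkalg k)
    (h : kalghom S T) (x : points G S) :
  kalghom_comp h (ginv x) = ginv (kalghom_comp h x : points G T).
Proof. by apply: gmul_inv_uniq; rewrite -gmul_natural gmulVg gone_natural. Qed.

Lemma on_pointsM (k : fieldType) (G H : affgrp k) (p : grphom G H)
    (S : comkalg k) (x y : points G S) :
  on_points p (gmul x y) = gmul (on_points p x) (on_points p y).
Proof. exact: grphom_mul. Qed.

Lemma on_points1 (k : fieldType) (G H : affgrp k) (p : grphom G H)
    (S : comkalg k) : on_points p (gone G S) = gone H S.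
Proof. by apply: gmul_idem; rewrite -on_pointsM gmul1g. Qed.

Lemma on_pointsV (k : fieldType) (G H : affgrp k) (p : grphom G H)
    (S : comkalg k) (x : points G S) :
  on_points p (ginv x) = ginv (on_points p x).
Proof. by apply: gmul_inv_uniq; rewrite -on_pointsM gmulVg on_points1. Qed.

Lemma on_points_comp (k : fieldType) (G H K : affgrp k) (q : grphom H K)
    (p : grphom G H) (S : comkalg k) (x : points G S) :
  on_points (grphom_comp q p) x = on_points q (on_points p x).
Proof. exact: kalghom_compA. Qed.

(** * Groups and closed subgroups from their points *)

(** The points of [A] form a subgroup of the product of the groups of points of
the [G i]: with one index this describes a subgroup, with two a product, with a
directed set a limit. *)
Record point_subgroup (k : fieldType) (I : Type) (G : I -> affgrp k)
    (A : comkalg k) (u : forall i, kalghom (coord (G i)) A) : Prop :=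
  PointSubgroup {
  ps_inj : forall S (x y : kalghom A S),
    (forall i, kalghom_comp x (u i) = kalghom_comp y (u i)) -> x = y;
  ps_mul : forall S (x y : kalghom A S), exists z : kalghom A S,
    forall i, kalghom_comp z (u i)
      = gmul (kalghom_comp x (u i)) (kalghom_comp y (u i));
  ps_one : forall S, exists z : kalghom A S,
    forall i, kalghom_comp z (u i) = gone (G i) S;
  ps_inv : forall S (x : kalghom A S), exists z : kalghom A S,
    forall i, kalghom_comp z (u i) = ginv (kalghom_comp x (u i)) }.

Definition ps_gmul (k : fieldType) (I : Type) (G : I -> affgrp k)
    (A : comkalg k) (u : forall i, kalghom (coord (G i)) A)
    (h : point_subgroup u) (S : comkalg k) (x y : kalghom A S) : kalghom A S :=
  projT1 (cid (ps_mul h x y)).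

Lemma ps_gmulE (k : fieldType) (I : Type) (G : I -> affgrp k)
    (A : comkalg k) (u : forall i, kalghom (coord (G i)) A)
    (h : point_subgroup u) (S : comkalg k) (x y : kalghom A S) i :
  kalghom_comp (ps_gmul h x y) (u i)
  = gmul (kalghom_comp x (u i)) (kalghom_comp y (u i)).
Proof. by rewrite /ps_gmul; case: cid. Qed.

Definition ps_gone (k : fieldType) (I : Type) (G : I -> affgrp k)
    (A : comkalg k) (u : forall i, kalghom (coord (G i)) A)
    (h : point_subgroup u) (S : comkalg k) : kalghom A S :=
  projT1 (cid (ps_one h S)).

Lemma ps_goneE (k : fieldType) (I : Type) (G : I -> affgrp k)
    (A : comkalg k) (u : forall i, kalghom (coord (G i)) A)
    (h : point_subgroup u) (S : comkalg k) i :
  kalghom_comp (ps_gone h S) (u i) = gone (G i) S.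
Proof. by rewrite /ps_gone; case: cid. Qed.

Definition ps_ginv (k : fieldType) (I : Type) (G : I -> affgrp k)
    (A : comkalg k) (u : forall i, kalghom (coord (G i)) A)
    (h : point_subgroup u) (S : comkalg k) (x : kalghom A S) : kalghom A S :=
  projT1 (cid (ps_inv h x)).

Lemma ps_ginvE (k : fieldType) (I : Type) (G : I -> affgrp k)
    (A : comkalg k) (u : forall i, kalghom (coord (G i)) A)
    (h : point_subgroup u) (S : comkalg k) (x : kalghom A S) i :
  kalghom_comp (ps_ginv h x) (u i) = ginv (kalghom_comp x (u i)).
Proof. by rewrite /ps_ginv; case: cid. Qed.

Definition ps_grp (k : fieldType) (I : Type) (G : I -> affgrp k)
  (A : comkalg k) (u : forall i, kalghom (coord (G i)) A)
  (h : point_subgroup u) : affgrp k.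
Proof.
refine (@AffGrp k A (ps_gmul h) (ps_gone h) (ps_ginv h) _ _ _ _ _ _) => S.
- by move=> x y z; apply: (ps_inj h) => i; rewrite !ps_gmulE gmulA.
- by move=> x; apply: (ps_inj h) => i; rewrite ps_gmulE ps_goneE gmul1g.
- by move=> x; apply: (ps_inj h) => i; rewrite ps_gmulE ps_goneE gmulg1.
- by move=> x; apply: (ps_inj h) => i; rewrite ps_gmulE ps_goneE ps_ginvE gmulVg.
- by move=> x; apply: (ps_inj h) => i; rewrite ps_gmulE ps_goneE ps_ginvE gmulgV.
- move=> T f x y; apply: (ps_inj h) => i; rewrite -kalghom_compA.
  by rewrite !ps_gmulE gmul_natural !kalghom_compA.
Defined.

Definition ps_proj (k : fieldType) (I : Type) (G : I -> affgrp k)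
    (A : comkalg k) (u : forall i, kalghom (coord (G i)) A)
    (h : point_subgroup u) i : grphom (ps_grp h) (G i) :=
  @GrpHom k (ps_grp h) (G i) (u i) (fun S x y => ps_gmulE h x y i).

Definition kills (k : fieldType) (A S : comkalg k) (E : set A)
  (x : kalghom A S) := forall a, E a -> x a = 0.

(** The points of the quotient of k[G] by [E] are the points that kill [E], and a
group law on these is all that has to be given. *)
Lemma cut_exists (k : fieldType) (G : affgrp k) (E : set (coord G)) :
  (forall S (x y : points G S), kills E x -> kills E y -> kills E (gmul x y)) ->
  (forall S, kills E (gone G S)) ->
  (forall S (x : points G S), kills E x -> kills E (ginv x)) ->
  exists K : closed_subgroup G,
    forall S (x : points G S), csub_points K S x <-> kills E x.
Proof.
move=> EM E1 EV; have [B [q [qs qE quniv]]] := quotient_exists E.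
have qx S (x : kalghom B S) : kills E (kalghom_comp x q).
  by move=> a Ea /=; rewrite qE // rmorph0.
have h : point_subgroup (fun _ : unit => q : kalghom (coord G) B).
  split=> [S x y xy|S x y|S|S x].
  - apply: kalghom_eq => b; have [a <-] := qs b.
    by rewrite -[LHS]/(kalghom_comp x q a) xy.
  - by have [z zE] := quniv _ _ (EM _ _ _ (qx _ x) (qx _ y)); exists z.
  - by have [z zE] := quniv _ _ (E1 S); exists z.
  - by have [z zE] := quniv _ _ (EV _ _ (qx _ x)); exists z.
exists (@ClosedSubgroup k G (ps_grp h) (ps_proj h tt) qs) => S x; split.
  by move=> [y _ <-]; exact: qx.
by move=> /quniv [y yE]; exists y.
Qed.

Lemma csub_pointsE (k : fieldType) (G : affgrp k) (K : closed_subgroup G)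
    (S : comkalg k) (x : points G S) :
  csub_points K S x <-> kills [set a | dual (csub_incl K) a = 0] x.
Proof.
split=> [[y _ <-] a /= a0|xK]; first by rewrite a0 rmorph0.
by have [y yE] := surj_factor (@csub_incl_closed _ _ K) xK; exists y.
Qed.

Lemma csub_pointsM (k : fieldType) (G : affgrp k) (K : closed_subgroup G)
    (S : comkalg k) (x y : points G S) :
  csub_points K S x -> csub_points K S y -> csub_points K S (gmul x y).
Proof. by move=> [x' _ <-] [y' _ <-]; exists (gmul x' y') => //; exact: on_pointsM. Qed.

Lemma csub_points1 (k : fieldType) (G : affgrp k) (K : closed_subgroup G)
    (S : comkalg k) : csub_points K S (gone G S).
Proof. by exists (gone _ S) => //; exact: on_points1. Qed.

Lemma csub_pointsV (k : fieldType) (G : affgrp k) (K : closed_subgroup G)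
    (S : comkalg k) (x : points G S) :
  csub_points K S x -> csub_points K S (ginv x).
Proof. by move=> [x' _ <-]; exists (ginv x') => //; exact: on_pointsV. Qed.

(** The intersection of all closed subgroups through [Y] is cut out by the functions
vanishing on its points: they contain the ideals of these subgroups. *)
Lemma generated_exists (k : fieldType) (G : affgrp k) (R : comkalg k)
    (Y : set (points G R)) : exists H : closed_subgroup G, is_generated Y H.
Proof.
pose inY S (x : points G S) := forall K : closed_subgroup G,
  Y `<=` csub_points K R -> csub_points K S x.
pose E := [set a | forall S (x : points G S), inY S x -> x a = 0].
have EE S (x : points G S) : kills E x <-> inY S x.
  split=> [xE K YK|xY a]; last by apply.
  by apply/csub_pointsE => a a0; apply: xE => T y /(_ K YK)/csub_pointsE; apply.
have [S x y /EE hx /EE hy|S|S x /EE hx|H HE] := @cut_exists k G E.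
- by apply/EE => K YK; apply: csub_pointsM; [exact: hx | exact: hy].
- by apply/EE => K YK; exact: csub_points1.
- by apply/EE => K YK; apply: csub_pointsV; exact: hx.
exists H; split=> [y Yy|K YK S x].
  by apply/HE/EE => K; apply.
by move=> /HE /EE; apply.
Qed.

Lemma preimage_exists (k : fieldType) (H G : affgrp k) (p : grphom H G)
    (K : closed_subgroup G) : exists L : closed_subgroup H,
  forall S (x : points H S), csub_points L S x <-> csub_points K S (on_points p x).
Proof.
pose E := [set dual p a | a in [set a | dual (csub_incl K) a = 0]].
have EE S (x : points H S) : kills E x <-> csub_points K S (on_points p x).
  split=> [xE|/csub_pointsE xK _ [a a0 <-]]; last exact: xK.
  by apply/csub_pointsE => a a0; apply: xE; exists a.
have [S x y /EE hx /EE hy|S|S x /EE hx|L LE] := @cut_exists k H E.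
- by apply/EE; rewrite on_pointsM; exact: csub_pointsM.
- by apply/EE; rewrite on_points1; exact: csub_points1.
- by apply/EE; rewrite on_pointsV; exact: csub_pointsV.
by exists L => S x; split=> [/LE/EE|/EE/LE].
Qed.

Lemma equalizer_exists (k : fieldType) (G H : affgrp k) (p q : grphom G H) :
  exists K : closed_subgroup G,
  forall S (x : points G S), csub_points K S x <-> on_points p x = on_points q x.
Proof.
pose E := [set dual p a - dual q a | a in setT].
have EE S (x : points G S) : kills E x <-> on_points p x = on_points q x.
  split=> [xE|xpq _ [a _ <-]].
    apply: kalghom_eq => a; apply/eqP; rewrite -subr_eq0 /= -rmorphB.
    by apply/eqP/xE; exists a.
  by rewrite rmorphB -[x _]/(on_points p x a) xpq subrr.
have [S x y /EE hx /EE hy|S|S x /EE hx|L LE] := @cut_exists k G E.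
- by apply/EE; rewrite !on_pointsM hx hy.
- by apply/EE; rewrite !on_points1.
- by apply/EE; rewrite !on_pointsV hx.
by exists L => S x; split=> [/LE/EE|/EE/LE].
Qed.

Lemma trivial_hom_exists (k : fieldType) (G H : affgrp k) :
  exists p : grphom G H, forall S (x : points G S), on_points p x = gone H S.
Proof.
have h S (x y : points G S) : kalghom_comp (gmul x y) (gone H (coord G))
    = gmul (kalghom_comp x (gone H (coord G)))
           (kalghom_comp y (gone H (coord G))).
  by rewrite !gone_natural gmul1g.
by exists (GrpHom h) => S x; exact: gone_natural.
Qed.

Lemma kernel_exists (k : fieldType) (G H : affgrp k) (p : grphom G H) :
  exists K : closed_subgroup G, normal_csub K /\
  forall S (x : points G S), csub_points K S x <-> on_points p x = gone H S.
Proof.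
have [e eE] := trivial_hom_exists G H; have [K KE] := equalizer_exists p e.
have {eE} KE S (x : points G S) : csub_points K S x <-> on_points p x = gone H S.
  by rewrite KE eE.
exists K; split=> // S g n /KE n1; apply/KE.
by rewrite !on_pointsM on_pointsV n1 gmulg1 gmulgV.
Qed.

(** * Images and generation *)

(** Let the points x and y of G kill the kernel of k[G] -> k[H], and let a be in
this kernel, with comultiplication the sum of the b_j (x) c_j.  The image of
this sum in the tensor square of k[H] is 0, as p is a morphism.  On the image
of k[G] the maps x and y are defined; extended linearly to k[H], they give a
bilinear map that sends the image of the sum to the sum of the x(b_j) y(c_j),
which is (xy)(a). *)
Lemma image_subgroup (k : fieldType) (H G : affgrp k) (p : grphom H G) :
  exists K : closed_subgroup G,
  forall S (x : points G S),
    csub_points K S x <-> kills [set a | dual p a = 0] x.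
Proof.
apply: cut_exists => [S x y xE yE a pa|S a pa|S x xE a pa].
- have ext (z : points G S) : kills [set a | dual p a = 0] z ->
    exists X : coord H -> S, [/\ {morph X : u v / u + v},
      forall c u, X (kalg_map _ c * u) = kalg_map S c * X u &
      forall b, X (dual p b) = z b].
    move=> zE.
    pose s u := if pselect (exists b, dual p b = u) is left h
      then projT1 (cid h) else 0.
    have sP b : dual p (s (dual p b)) = dual p b.
      by rewrite /s; case: pselect => [h|[]]; [case: cid | exists b].
    have zs b : z (s (dual p b)) = z b.
      apply/eqP; rewrite -subr_eq0 -rmorphB; apply/eqP/zE => /=.
      by rewrite rmorphB sP subrr.
    have [|||||X [XD XZ XE]] := @linear_extension k (coord H) S
      (range (dual p)) (fun u => z (s u)).
    + by exists 0 => //; rewrite rmorph0.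
    + by move=> _ _ [b _ <-] [c _ <-]; exists (b + c) => //; rewrite rmorphD.
    + move=> c _ [b _ <-]; exists (kalg_map _ c * b) => //; exact: kalghomZ.
    + by move=> _ _ [b _ <-] [c _ <-]; rewrite -rmorphD !zs rmorphD.
    + by move=> c _ [b _ <-]; rewrite -kalghomZ !zs kalghomZ.
    by exists X; split=> // b; rewrite XE ?zs //; exists b.
  have [X [XD XZ XE]] := ext _ xE; have [Y [YD YZ YE]] := ext _ yE.
  have [l lE] := comult_exists a.
  have [T [i1 [i2 [_ bl _]]]] := tensor_exists (coord H) (coord H).
  have hF := bilin_prod XD XZ YD YZ.
  pose l' := [seq (dual p q.1, dual p q.2) | q <- l].
  have l'0 : pairing (fun b c => i1 b * i2 c) l' = pairing (fun b c => i1 b * i2 c) [::].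
    rewrite /pairing big_nil big_map -[LHS](lE _ (on_points p i1) (on_points p i2)).
    by rewrite -on_pointsM /= pa rmorph0.
  have := bl _ _ _ _ hF l'0; rewrite /pairing big_nil big_map /= => XY0.
  rewrite lE -[RHS]XY0; apply: eq_bigr => q _; by rewrite XE YE.
- by rewrite -(on_points1 p) /= pa rmorph0.
(* The inverse of [x] is [x] composed with the antipode, which commutes with
   [dual p]. *)
- have -> : ginv x = kalghom_comp x (ginv (kalghom_id (coord G) : points G _)).
    by rewrite ginv_natural kalghom_comp1.
  apply: xE => /=.
  have -> (b : coord G) : dual p (ginv (kalghom_id (coord G) : points G _) b)
      = on_points p (ginv (kalghom_id (coord H) : points H _)) b.
    rewrite on_pointsV -[LHS]/(kalghom_comp (dual p) (ginv _) b) ginv_natural.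
    congr (ginv _ b); exact: kalghom_eq.
  by rewrite /= pa rmorph0.
Qed.

(** Equivalent to <phi(X)> = G by [generating_whole], without the choice of a
representative of <phi(X)>. *)
Definition generating (k : fieldType) (X : Type) (G : affgrp k) (R : comkalg k)
    (phi : X -> points G R) :=
  forall K : closed_subgroup G, (forall x, csub_points K R (phi x)) ->
    forall S (g : points G S), csub_points K S g.

(** The image of [p] is a closed subgroup through the generators, so it contains
the universal point of [G]. *)
Lemma generating_epi (k : fieldType) (X : Type) (G H : affgrp k) (R : comkalg k)
    (p : grphom H G) (phi : X -> points H R) :
  generating (fun x => on_points p (phi x)) -> epimorphism p.
Proof.
have [K KE] := image_subgroup p => gen a b pab.
have /KE : csub_points K _ (kalghom_id (coord G) : points G _).
  by apply: gen => x; apply/KE => c c0 /=; rewrite c0 rmorph0.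
move=> /(_ (a - b)) /=; rewrite rmorphB pab subrr => /(_ erefl)/eqP.
by rewrite subr_eq0 => /eqP.
Qed.

(** The equalizer of [p] and [q] is a closed subgroup through the generators. *)
Lemma generating_eq (k : fieldType) (X : Type) (G H : affgrp k) (R : comkalg k)
    (phi : X -> points G R) (p q : grphom G H) :
  generating phi -> (forall x, on_points p (phi x) = on_points q (phi x)) -> p = q.
Proof.
have [K KE] := equalizer_exists p q => gen pq.
have /KE : csub_points K _ (kalghom_id (coord G) : points G _).
  by apply: gen => x; apply/KE.
move=> h; apply: grphom_eq; apply: kalghom_eq => a.
by move/(congr1 (fun f : points H _ => f a)): h.
Qed.

Lemma generating_whole (k : fieldType) (X : Type) (G : affgrp k) (R : comkalg k)
    (phi : X -> points G R) :
  generating phi <-> is_generated (range phi) (whole G).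
Proof.
have wh S (g : points G S) : csub_points (whole G) S g.
  by exists g => //; exact: kalghom_comp1.
split=> [gen|[_ gen] K phiK S g].
  split=> [y _|K YK S g _]; first exact: wh.
  by apply: gen => x; apply: YK; exists x.
by apply: gen (wh _ _) => _ [x _ <-].
Qed.

(** A closed subgroup of [H] through the lifted generators is a closed subgroup of
[G] through [range phi]. *)
Lemma generating_csub (k : fieldType) (X : Type) (G : affgrp k) (R : comkalg k)
    (phi : X -> points G R) (H : closed_subgroup G) :
  is_generated (range phi) H ->
  exists2 psi : X -> points (csub H) R,
    generating psi & forall x, on_points (csub_incl H) (psi x) = phi x.
Proof.
move=> [phiH Hmin].
have lift x : exists y : points (csub H) R, on_points (csub_incl H) y = phi x.
  by have [|y _ yE] := phiH (phi x); [exists x | exists y].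
exists (fun x => projT1 (cid (lift x))) => [K psiK S g|x]; last by case: cid.
have KH_closed : closed_immersion (grphom_comp (csub_incl H) (csub_incl K)).
  move=> c; have [b <-] := csub_incl_closed c.
  by have [a <-] := csub_incl_closed b; exists a.
have [||y _ yE] := Hmin (ClosedSubgroup KH_closed) _ S (on_points (csub_incl H) g).
- move=> _ [x _ <-]; have [y _ yE] := psiK x; exists y => //.
  by rewrite on_points_comp yE; case: cid.
- by exists g.
exists y => //; apply: kalghom_eq => b; have [a <-] := csub_incl_closed b.
by move/(congr1 (fun f : points G _ => f a)): yE.
Qed.

(** The preimage of a closed subgroup through the images of the generators is
[G], so the dual of [p] sends the equations of this subgroup to 0. *)
Lemma generating_on_points (k : fieldType) (X : Type) (G H : affgrp k)
    (R : comkalg k) (p : grphom G H) (phi : X -> points G R) :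
  epimorphism p -> generating phi -> generating (fun x => on_points p (phi x)).
Proof.
move=> epi gen K pK.
have [L LE] := preimage_exists p K.
have /LE/csub_pointsE h : csub_points L _ (kalghom_id (coord G) : points G _).
  by apply: gen => x; apply/LE.
move=> S g; apply/csub_pointsE => a /h /=.
by rewrite -(rmorph0 (dual p)) => /epi ->; rewrite rmorph0.
Qed.

(** * Products and limits *)

Lemma product_exists (k : fieldType) (G1 G2 : affgrp k) :
  exists (P : affgrp k) (pr1 : grphom P G1) (pr2 : grphom P G2),
    is_product pr1 pr2.
Proof.
have [T [i1 [i2 [gen _ univ]]]] := tensor_exists (coord G1) (coord G2).
pose G b := if b then G1 else G2.
pose u b : kalghom (coord (G b)) T :=
  match b return kalghom (coord (G b)) T with true => i1 | false => i2 end.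
have uniq S (x y : kalghom T S) : kalghom_comp x i1 = kalghom_comp y i1 ->
    kalghom_comp x i2 = kalghom_comp y i2 -> x = y.
  move=> xy1 xy2; apply: kalghom_eq => z; have [l ->] := gen z.
  rewrite /pairing !rmorph_sum; apply: eq_bigr => q _; rewrite !rmorphM.
  rewrite -[x (i1 _)]/(kalghom_comp x i1 _) -[x (i2 _)]/(kalghom_comp x i2 _).
  by rewrite xy1 xy2.
have h : point_subgroup u.
  split=> [S x y xy|S x y|S|S x].
  - by apply: uniq; [exact: (xy true) | exact: (xy false)].
  - have [z [z1 z2]] := univ S (gmul (kalghom_comp x i1) (kalghom_comp y i1))
      (gmul (kalghom_comp x i2) (kalghom_comp y i2)).
    by exists z; case.
  - have [z [z1 z2]] := univ S (gone G1 S) (gone G2 S).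
    by exists z; case.
  - have [z [z1 z2]] := univ S (ginv (kalghom_comp x i1)) (ginv (kalghom_comp x i2)).
    by exists z; case.
exists (ps_grp h), (ps_proj h true), (ps_proj h false) => S x1 x2.
have [z [z1 z2]] := univ S x1 x2; exists z; split=> // y [y1 y2].
by apply: uniq; rewrite ?z1 ?z2; apply/esym.
Qed.

Lemma limit_colim (k : fieldType) (I : Type) (le : I -> I -> Prop)
    (F : I -> affgrp k) (t : forall i j, le i j -> grphom (F j) (F i))
    (G : affgrp k) (p : forall i, grphom G (F i)) :
  is_limit t p <->
  is_colim (fun i j h => dual (t i j h)) (fun i => dual (p i)).
Proof.
split=> -[cp univ]; split=> //.
  by move=> i j h; rewrite -(cp i j h).
by move=> i j h; apply: grphom_eq; rewrite -(cp i j h).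
Qed.

Lemma limit_exists (k : fieldType) (I : Type) (le : I -> I -> Prop)
    (F : I -> affgrp k) (t : forall i j, le i j -> grphom (F j) (F i)) :
  directed le ->
  exists (G : affgrp k) (p : forall i, grphom G (F i)), is_limit t p.
Proof.
move=> dir.
have [B [u [[cu uni] usurj]]] := colim_exists (fun i j h => dual (t i j h)) dir.
have cB S (x : kalghom B S) i j (h : le i j) :
    on_points (t i j h) (kalghom_comp x (u j)) = kalghom_comp x (u i).
  by rewrite /on_points -kalghom_compA cu.
have h : point_subgroup (u : forall i, kalghom (coord (F i)) B).
  split=> [S x y xy|S x y|S|S x].
  - apply: kalghom_eq => b; have [i [a <-]] := usurj b.
    by rewrite -[LHS]/(kalghom_comp x (u i) a) xy.
  - have [|z [zE _]] := uni S (fun i => gmul (kalghom_comp x (u i)) (kalghom_comp y (u i))).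
      by move=> i j h; rewrite -[LHS]/(on_points _ _) on_pointsM !cB.
    by exists z.
  - have [|z [zE _]] := uni S (fun i => gone (F i) S).
      by move=> i j h; exact: on_points1.
    by exists z.
  - have [|z [zE _]] := uni S (fun i => ginv (kalghom_comp x (u i))).
      by move=> i j h; rewrite -[LHS]/(on_points _ _) on_pointsV !cB.
    by exists z.
by exists (ps_grp h), (ps_proj h); apply/limit_colim.
Qed.

Lemma limit_surj (k : fieldType) (I : Type) (le : I -> I -> Prop)
    (F : I -> affgrp k) (t : forall i j, le i j -> grphom (F j) (F i))
    (G : affgrp k) (p : forall i, grphom G (F i)) :
  directed le -> is_limit t p -> forall b, exists i a, dual (p i) a = b.
Proof. by move=> dir /limit_colim /(colim_surjective dir). Qed.

Lemma limit_epi (k : fieldType) (I : Type) (le : I -> I -> Prop)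
    (F : I -> affgrp k) (t : forall i j, le i j -> grphom (F j) (F i))
    (G : affgrp k) (p : forall i, grphom G (F i)) :
  directed le -> inverse_system t ->
  (forall i j (h : le i j), epimorphism (t i j h)) ->
  is_limit t p -> forall i, epimorphism (p i).
Proof.
move=> dir [_ tcomp] tepi /limit_colim; apply: colim_injective => //.
by move=> i j l ij jl il; rewrite (tcomp _ _ _ ij jl il).
Qed.

(** The limit property gives a map on coordinate rings; it is compatible with
products because these are determined by their projections. *)
Lemma limit_hom (k : fieldType) (I : Type) (le : I -> I -> Prop)
    (F : I -> affgrp k) (t : forall i j, le i j -> grphom (F j) (F i))
    (G : affgrp k) (p : forall i, grphom G (F i)) (H : affgrp k)
    (q : forall i, grphom H (F i)) :
  is_limit t p -> (forall i j (h : le i j), grphom_comp (t i j h) (q j) = q i) ->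
  exists r : grphom H G, forall i, grphom_comp (p i) r = q i.
Proof.
move=> [cp uni] cq.
have [|r [rE _]] := uni (coord H) (fun i => dual (q i)).
  by move=> i j h; rewrite -(cq i j h).
have rM S (x y : points H S) : kalghom_comp (gmul x y) r
    = gmul (kalghom_comp x r : points G S) (kalghom_comp y r).
  have q_pts (z : points H S) i :
      on_points (p i) (kalghom_comp z r) = on_points (q i) z.
    by rewrite /on_points -kalghom_compA [kalghom_comp r _]rE.
  have [|g [_ guniq]] := uni S (fun i => on_points (q i) (gmul x y)).
    by move=> i j h; rewrite -on_points_comp cq.
  rewrite -(guniq (kalghom_comp (gmul x y) r)) => [|i]; last exact: q_pts.
  by apply: guniq => i; rewrite !on_pointsM !q_pts.
by exists (GrpHom rM) => i; apply: grphom_eq; exact: rE.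
Qed.

(** * Stages of a limit and finite type *)

Lemma directed_range (k : fieldType) (I : Type) (le : I -> I -> Prop)
    (A : I -> comkalg k) (t : forall i j, le i j -> kalghom (A i) (A j))
    (B : comkalg k) (u : forall i, kalghom (A i) B) (s : seq B) :
  directed le -> cone t u -> (forall b, exists i a, u i a = b) ->
  exists i, forall b, b \in s -> exists a, u i a = b.
Proof.
move=> dir cu us; elim: s => [|b s [i iP]].
  by have [i _] := directed_inhabited dir; exists i.
have [j [a aE]] := us b; have [l [il jl]] := directed_ub dir i j.
exists l => c; rewrite inE => /orP[/eqP ->|/iP [a' <-]].
  by exists (t j l jl a); rewrite -aE -(cu _ _ jl).
by exists (t i l il a'); rewrite -(cu _ _ il).
Qed.

Lemma finite_type_range (k : fieldType) (I : Type) (le : I -> I -> Prop)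
    (A : I -> comkalg k) (t : forall i j, le i j -> kalghom (A i) (A j))
    (B : comkalg k) (u : forall i, kalghom (A i) B) (D : comkalg k)
    (g : kalghom D B) :
  directed le -> cone t u -> (forall b, exists i a, u i a = b) ->
  finite_type D -> exists i, forall d, exists a, u i a = g d.
Proof.
move=> dir cu us [n [f fs]].
have [i iP] := directed_range [seq g (f ('X_m : {mpoly k[n]})) | m <- enum 'I_n]
  dir cu us.
exists i => d; have [q <-] := fs d.
elim/mpolyind: q => [|c m q _ _ [a aE]]; first by exists 0; rewrite !rmorph0.
have prodP (v : 'I_n -> nat) : exists a, u i a = g (f (\prod_(j < n) 'X_j ^+ v j : {mpoly k[n]})).
  rewrite !rmorph_prod /=.
  apply: (big_ind (fun b => exists a, u i a = b)) => [|_ _ [a1 <-] [a2 <-]|j _].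
  - by exists 1; rewrite rmorph1.
  - by exists (a1 * a2); rewrite rmorphM.
  - have [|b bE] := iP (g (f ('X_j : {mpoly k[n]}))).
      by apply/map_f; rewrite mem_enum.
    by exists (b ^+ v j); rewrite !rmorphXn /= bE.
have [b bE] := prodP m; exists (kalg_map (A i) c * b + a).
rewrite rmorphD aE rmorphM kalghom_map bE !rmorphD -mul_mpolyC -mpolyXE_id.
by rewrite !rmorphM -[f c%:MP]/(f (kalg_map (polyalg k n) c)) !kalghom_map.
Qed.

(** The coordinate ring of [Q] lands in a single stage [i], so that the points
trivial at [i] become trivial in [Q]. *)
Lemma stage_support (k : fieldType) (X I : Type) (le : I -> I -> Prop)
    (F : I -> affgrp k) (t : forall i j, le i j -> grphom (F j) (F i))
    (H : affgrp k) (q : forall i, grphom H (F i)) (Q : affgrp k)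
    (r : grphom H Q) (R : comkalg k) (psi : X -> points H R) :
  directed le -> (forall i j (h : le i j), grphom_comp (t i j h) (q j) = q i) ->
  (forall b, exists i a, dual (q i) a = b) -> algebraic Q ->
  (forall i, finite_set [set x | on_points (q i) (psi x) <> gone (F i) R]) ->
  finite_set [set x | on_points r (psi x) <> gone Q R].
Proof.
move=> dir cq qs algQ supp.
have [|i iP] := finite_type_range (dual r) dir _ qs algQ (t := fun i j h => dual (t i j h)).
  by move=> i j h; rewrite -(cq i j h).
apply: sub_finite_set (supp i) => x /= rx qx; apply: rx.
apply: kalghom_eq => d; have [a aE] := iP d.
rewrite -(on_points1 r) /= -aE.
rewrite -[LHS]/(on_points (q i) (psi x) a) qx.
by rewrite -(on_points1 (q i)).
Qed.

(** The map from [k] to a coordinate ring is injective because the unit point is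
a retraction of it. *)
Lemma trivial_exists (k : fieldType) : exists T : affgrp k,
  (forall (S : comkalg k) (x y : points T S), x = y) /\
  forall G : affgrp k, exists p : grphom G T, epimorphism p.
Proof.
pose K := @ComKAlg k k (@idfun k).
have uniq (S : comkalg k) (x y : kalghom K S) : x = y.
  by apply: kalghom_eq => c; rewrite -[c]/(kalg_map K c) !kalghom_map.
pose e (S : comkalg k) : kalghom K S :=
  @KAlgHom k K S (kalg_map S) (fun c => erefl).
pose T := @AffGrp k K (fun S x _ => x) e (fun S x => x)
  (fun S x y z => uniq _ _ _) (fun S x => uniq _ _ _) (fun S x => uniq _ _ _)
  (fun S x => uniq _ _ _) (fun S x => uniq _ _ _)
  (fun S U h x y => uniq _ _ _).
exists T; split=> // G.
exists (@GrpHom k G T (e (coord G)) (fun S x y => uniq _ _ _)) => c d /= cd.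
have gc : gone G K \o kalg_map (coord G) =1 id by move=> a /=; rewrite kalghom_map.
by rewrite -[c]gc -[d]gc /= cd.
Qed.

(** * Admissible pairs and their codes *)

(** A group of finite type with a map [X -> G(R)], encoded on a polynomial ring
that surjects to k[G]: [code_comult a l] records that [l] represents the
comultiplication of the image of [a].  The groups themselves are too many to
index a colimit of algebras. *)
Record code (k : fieldType) (X : Type) (R : comkalg k) := Code {
  code_gens : nat;
  code_comult : polyalg k code_gens ->
    seq (polyalg k code_gens * polyalg k code_gens) -> Prop;
  code_map : X -> polyalg k code_gens -> R }.
Arguments code_comult {k X R} c a l.
Arguments code_map {k X R} c x a.

Definition realizes (k : fieldType) (X : Type) (R : comkalg k) (c : code X R)
    (G : affgrp k) (phi : X -> points G R) :=
  exists f : kalghom (polyalg k (code_gens c)) (coord G),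
  [/\ surj f,
    forall a l, code_comult c a l <-> forall (S : comkalg k) (x y : points G S),
      gmul x y (f a) = pairing (fun b c => x (f b) * y (f c)) l &
    forall x a, code_map c x a = phi x (f a)].

Lemma realized (k : fieldType) (X : Type) (R : comkalg k)
    (G : affgrp k) (phi : X -> points G R) :
  algebraic G -> exists c : code X R, realizes c phi.
Proof.
move=> [n [f fs]].
exists (@Code k X R n (fun a l => forall (S : comkalg k) (x y : points G S),
      gmul x y (f a) = pairing (fun b c => x (f b) * y (f c)) l)
   (fun x a => phi x (f a))).
by exists f.
Qed.

(** Both coordinate rings are quotients of one polynomial ring, by the same kernel:
the polynomials whose comultiplication is represented by the empty list.  The
isomorphism is multiplicative since each comultiplication is represented by some
list. *)
Lemma realizes_hom (k : fieldType) (X : Type) (R : comkalg k) (c : code X R)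
    (G G' : affgrp k) (phi : X -> points G R) (phi' : X -> points G' R) :
  realizes c phi -> realizes c phi' ->
  exists p : grphom G G', forall x, on_points p (phi x) = phi' x.
Proof.
move=> [f [fs fM fphi]] [f' [fs' fM' fphi']].
have [|r rE] := surj_factor fs' (x := f).
  (* At the points [id] and 1, a product given by the empty list is [f a = 0]. *)
  move=> a a0; have /fM/(_ _ (kalghom_id (coord G)) (gone G _)) : code_comult c a [::].
    by apply/fM' => S x y; rewrite a0 rmorph0 /pairing big_nil.
  by rewrite gmulg1 /pairing big_nil.
have rf a : r (f' a) = f a by rewrite -rE.
have rM S (x y : points G S) : kalghom_comp (gmul x y) r
    = gmul (kalghom_comp x r : points G' S) (kalghom_comp y r).
  apply: kalghom_eq => b; have [a <-] := fs' b.
  have [l lE] := comult_exists (f' a).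
  pose s b' := projT1 (cid (fs' b')).
  have sK b' : f' (s b') = b' by rewrite /s; case: cid.
  have al : code_comult c a [seq (s p.1, s p.2) | p <- l].
    apply/fM' => U z w; rewrite lE /pairing big_map.
    by apply: eq_bigr => p _ /=; rewrite !sK.
  move/fM: (al) => /(_ S x y) xyE; move/fM': al => -> /=; rewrite rf xyE.
  by rewrite /pairing; apply: eq_bigr => p _; rewrite /= !rf.
exists (GrpHom rM) => x; apply: kalghom_eq => b; have [a <-] := fs' b.
by rewrite /= rf -fphi -fphi'.
Qed.

Definition admissible (k : fieldType) (X : Type) (C : affgrp k -> Prop)
    (R : comkalg k) (G : affgrp k) (phi : X -> points G R) :=
  [/\ C G, finite_set [set x | phi x <> gone G R] & generating phi].

Record stage (k : fieldType) (X : Type) (C : affgrp k -> Prop) (R : comkalg k) :=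
  Stage {
  st_code : code X R;
  stP : exists D : {G : affgrp k & X -> points G R},
    admissible C (projT2 D) /\ realizes st_code (projT2 D) }.

Definition st_grp (k : fieldType) (X : Type) (C : affgrp k -> Prop)
    (R : comkalg k) (s : stage X C R) : affgrp k := projT1 (projT1 (cid (stP s))).
Definition st_map (k : fieldType) (X : Type) (C : affgrp k -> Prop)
    (R : comkalg k) (s : stage X C R) : X -> points (st_grp s) R :=
  projT2 (projT1 (cid (stP s))).

Lemma st_admissible (k : fieldType) (X : Type) (C : affgrp k -> Prop)
    (R : comkalg k) (s : stage X C R) : admissible C (st_map s).
Proof. by have [] := projT2 (cid (stP s)). Qed.

Lemma st_realizes (k : fieldType) (X : Type) (C : affgrp k -> Prop)
    (R : comkalg k) (s : stage X C R) : realizes (st_code s) (st_map s).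
Proof. by have [] := projT2 (cid (stP s)). Qed.

Lemma stage_exists (k : fieldType) (X : Type) (C : affgrp k -> Prop)
    (R : comkalg k) (G : affgrp k) (phi : X -> points G R) :
  formation C -> admissible C phi -> exists (s : stage X C R)
    (p : grphom (st_grp s) G), forall x, on_points p (st_map s x) = phi x.
Proof.
move=> hC adm; have [CG _ _] := adm.
have [c cP] := realized phi (formation_algebraic hC CG).
have sP : exists D : {G : affgrp k & X -> points G R},
    admissible C (projT2 D) /\ realizes c (projT2 D) by exists (existT _ G phi).
exists (Stage sP); exact: realizes_hom (st_realizes (Stage sP)) cP.
Qed.

Definition st_le (k : fieldType) (X : Type) (C : affgrp k -> Prop)
    (R : comkalg k) (s r : stage X C R) : Prop :=
  exists p : grphom (st_grp r) (st_grp s),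
    forall x, on_points p (st_map r x) = st_map s x.

Lemma closed_immersion_inj (k : fieldType) (G H : affgrp k) (j : grphom G H)
    (S : comkalg k) : closed_immersion j -> injective (@on_points k G H j S).
Proof.
move=> js x y xy; apply: kalghom_eq => b; have [a <-] := js b.
by move/(congr1 (fun f : points H S => f a)): xy.
Qed.

(** The upper bound of two stages is the subgroup of their product generated by
the pairs of values; the trivial group, a quotient of any member of [C], shows
that there is a stage. *)
Lemma st_directed (k : fieldType) (X : Type) (C : affgrp k -> Prop)
    (R : comkalg k) : formation C -> directed (@st_le k X C R).
Proof.
move=> hC; split.
- have [T [Tuniq Tepi]] := trivial_exists k.
  have [G0 [CG0 _]] := formation_nontrivial hC; have [p epi] := Tepi G0.
  have [|s _] := @stage_exists k X C R T (fun _ => gone T R) hC; last by exists s.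
  split=> [||K _ S g].
  + exact: formation_quotient epi CG0.
  + by apply: (sub_finite_set _ (finite_set0 X)) => x /= [].
  + by rewrite (Tuniq _ g (gone T S)); exact: csub_points1.
- by move=> s; exists (grphom_id _) => x; exact: kalghom_comp1.
- move=> s r q [p pE] [p' pE']; exists (grphom_comp p p') => x.
  by rewrite on_points_comp pE' pE.
move=> s r.
have [Cs fs gs] := st_admissible s; have [Cr fr gr] := st_admissible r.
have [P [pr1 [pr2 prod]]] := product_exists (st_grp s) (st_grp r).
pose theta x := projT1 (cid (prod R (st_map s x) (st_map r x))).
have theta1 x : on_points pr1 (theta x) = st_map s x.
  by rewrite /theta; case: cid => ? [[]].
have theta2 x : on_points pr2 (theta x) = st_map r x.
  by rewrite /theta; case: cid => ? [[]].
have [H Hgen] := generated_exists (range theta).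
have [psi psi_gen psiE] := generating_csub Hgen.
pose q1 := grphom_comp pr1 (csub_incl H); pose q2 := grphom_comp pr2 (csub_incl H).
have q1E x : on_points q1 (psi x) = st_map s x.
  by rewrite on_points_comp psiE theta1.
have q2E x : on_points q2 (psi x) = st_map r x.
  by rewrite on_points_comp psiE theta2.
have epi1 : epimorphism q1.
  by apply: (@generating_epi _ _ _ _ _ _ psi); under eq_fun do rewrite q1E.
have epi2 : epimorphism q2.
  by apply: (@generating_epi _ _ _ _ _ _ psi); under eq_fun do rewrite q2E.
have adm : admissible C psi.
  split=> //; first exact: (@formation_subdirect _ _ hC _ _ _ _ _ H Cs Cr prod epi1 epi2).
  have fsr : finite_set ([set x | st_map s x <> gone _ R]
      `|` [set x | st_map r x <> gone _ R]) by rewrite finite_setU.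
  apply: sub_finite_set fsr => x /= psix; apply: contrapT => /not_orP [].
  move=> /contrapT s1 /contrapT r1; apply: psix.
  apply: (closed_immersion_inj (@csub_incl_closed _ _ H)).
  rewrite psiE on_points1.
  have [z [_ zuniq]] := prod R (gone _ R) (gone _ R).
  rewrite -(zuniq (theta x)); last by rewrite theta1 theta2.
  by apply: zuniq; rewrite !on_points1.
have [l [p pE]] := stage_exists hC adm.
exists l; split.
  by exists (grphom_comp q1 p) => x; rewrite on_points_comp pE q1E.
by exists (grphom_comp q2 p) => x; rewrite on_points_comp pE q2E.
Qed.

(** Let H = <phi(X)> be the limit of the H_j.  The generators of k[H_j] lift to k[G]
and hence come from one stage of [G], whose kernel is coalgebraic; so [phi] has
finite support in H_j, and H_j is dominated by a stage of [Gamma]. *)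
Lemma pro_universal (k : fieldType) (X : Type) (C : affgrp k -> Prop)
    (R : comkalg k) (Gamma : affgrp k)
    (pi : forall s : stage X C R, grphom Gamma (st_grp s))
    (iota : X -> points Gamma R) :
  formation C -> generating iota ->
  (forall s x, on_points (pi s) (iota x) = st_map s x) ->
  forall (G : affgrp k) (phi : X -> points G R),
    pro C G -> converges_to_1 phi -> generates_pro C (range phi) ->
    exists! psi : grphom Gamma G, forall x, on_points psi (iota x) = phi x.
Proof.
move=> hC gen piE G phi [J [leJ [F [t [p [dirJ sysJ epiJ CF limG]]]]]] conv.
move=> [H [Hgen [J' [leJ' [F' [t' [p' [dirJ' sysJ' epiJ' CF' limH]]]]]]]].
have [psi psi_gen psiE] := generating_csub Hgen.
have p_epi := limit_epi dirJ sysJ epiJ limG.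
have p'_epi := limit_epi dirJ' sysJ' epiJ' limH.
have supp j : finite_set [set x | on_points (p' j) (psi x) <> gone (F' j) R].
  apply: (@stage_support _ _ _ _ _ t _ (fun i => grphom_comp (p i) (csub_incl H))
    _ (p' j) R psi dirJ).
  - move=> i l h; apply: grphom_eq; have [cp _] := limG.
    by rewrite -(cp i l h); exact: kalghom_eq.
  - move=> b; have [a <-] := @csub_incl_closed _ _ H b.
    by have [i [d <-]] := limit_surj dirJ limG a; exists i, d.
  - exact: (formation_algebraic hC (CF' j)).
  - move=> i; have [N [Nnorm NE]] := kernel_exists (p i).
    have coN : coalgebraic N.
      by split=> //; exists (F i), (p i); split=> //; exact: (formation_algebraic hC (CF i)).
    apply: sub_finite_set (conv N coN) => x /= px Nx; apply: px.
    by rewrite on_points_comp psiE; apply/NE.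
have lift j : exists r : grphom Gamma (F' j),
    forall x, on_points r (iota x) = on_points (p' j) (psi x).
  have [|s [r rE]] := @stage_exists _ _ _ _ _ (fun x => on_points (p' j) (psi x)) hC.
    by split; [exact: CF' | exact: supp | exact: generating_on_points].
  by exists (grphom_comp r (pi s)) => x; rewrite on_points_comp piE rE.
pose r j := projT1 (cid (lift j)).
have rE j x : on_points (r j) (iota x) = on_points (p' j) (psi x).
  by rewrite /r; case: cid.
have [|m mE] := limit_hom (q := r) limH.
  move=> i j h; apply: (generating_eq gen) => x.
  by rewrite on_points_comp !rE -on_points_comp; have [-> _] := limH.
have miota x : on_points m (iota x) = psi x.
  have [_ uni] := limH.
  have [|g [_ guniq]] := uni R (fun j => on_points (p' j) (psi x)).
    by move=> i j h; rewrite -on_points_comp; have [-> _] := limH.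
  rewrite -(guniq (psi x)) //; apply/esym/guniq => j.
  by rewrite -on_points_comp mE rE.
exists (grphom_comp (csub_incl H) m); split=> [x|m' m'E].
  by rewrite on_points_comp miota psiE.
apply: (generating_eq gen) => x; by rewrite on_points_comp miota psiE m'E.
Qed.

Theorem theorem2p17 (k : fieldType) (X : Type) (C : affgrp k -> Prop)
    (hC : formation C) (R : comkalg k) :
  exists (Gamma : affgrp k) (iota : X -> points Gamma R),
    pro C Gamma /\
    (converges_to_1 iota /\ generates_pro C (range iota)) /\
    (forall (G : affgrp k) (phi : X -> points G R),
        pro C G -> converges_to_1 phi -> generates_pro C (range phi) ->
        exists! psi : grphom Gamma G,
          forall x : X, on_points psi (iota x) = phi x) /\
    is_generated (range iota) (whole Gamma).
Proof.
pose I := stage X C R; pose le : I -> I -> Prop := @st_le k X C R.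
have dir : directed le by exact: st_directed.
pose t (i j : I) (h : le i j) : grphom (st_grp j) (st_grp i) := projT1 (cid h).
have tE i j (h : le i j) x : on_points (t i j h) (st_map j x) = st_map i x.
  by rewrite /t; case: cid.
have genI (i : I) : generating (st_map i) by have [] := st_admissible i.
have CI (i : I) : C (st_grp i) by have [] := st_admissible i.
have sys : inverse_system t.
  split=> [i h|i j l ij jl il].
    apply: (generating_eq (genI i)) => x; rewrite tE; apply/esym.
    exact: kalghom_comp1.
  by apply: (generating_eq (genI l)) => x; rewrite on_points_comp !tE.
have epi i j (h : le i j) : epimorphism (t i j h).
  apply: (@generating_epi _ _ _ _ _ _ (st_map j)).
  under eq_fun do rewrite tE; exact: genI.
have [Gamma [pi lim]] := limit_exists t dir.
have iotaP x : exists g : points Gamma R, forall i, on_points (pi i) g = st_map i x.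
  have [_ uni] := lim.
  by have [|g [gE _]] := uni R (fun i => st_map i x); [move=> i j h; exact: tE | exists g].
pose iota x := projT1 (cid (iotaP x)).
have iotaE i x : on_points (pi i) (iota x) = st_map i x.
  by rewrite /iota; case: cid.
have gen : generating iota.
  move=> K iotaK S g; apply/csub_pointsE => a aK.
  have [i [b bE]] := limit_surj dir lim a.
  have lift x : exists y : points (csub K) R, on_points (csub_incl K) y = iota x.
    by have [y _ yE] := iotaK x; exists y.
  (* A function on [Gamma] that vanishes on [K] comes from a stage [i], and it
     vanishes there since [K] maps onto this stage. *)
  have epiK : epimorphism (grphom_comp (pi i) (csub_incl K)).
    apply: (@generating_epi _ _ _ _ _ _ (fun x => projT1 (cid (lift x)))).
    have <- : st_map i = fun x => on_points (grphom_comp (pi i) (csub_incl K))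
        (projT1 (cid (lift x))).
      by apply: funext => x; rewrite on_points_comp; case: cid => y /= ->.
    exact: genI.
  have b0 : b = 0 by apply: epiK; rewrite rmorph0 /= bE.
  by rewrite -bE b0 !rmorph0.
have proG : pro C Gamma by exists I, le, (fun i => st_grp i), t, pi.
have whole_gen := iffLR (generating_whole iota) gen.
exists Gamma, iota; split=> //; split; last by split=> //; exact: (pro_universal hC gen iotaE).
split; last by exists (whole Gamma).
move=> N [_ [Q [p [[_ NE] algQ]]]].
have -> : [set x | ~ csub_points N R (iota x)]
    = [set x | on_points p (iota x) <> gone Q R].
  by apply/seteqP; split=> x /= + /NE.
have [cpi _] := lim.
apply: (stage_support p dir cpi (limit_surj dir lim) algQ) => i.
have [_ fin _] := st_admissible i.
by apply: sub_finite_set fin => x /=; rewrite iotaE.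
Qed.
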